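(* Let $V \subset (\mathbb{R}_{>0})^n$ be a semi-algebraic set. Then $\mathcal{A}_0(V) \cap \mathbb{Q}^n$ is dense in $\mathcal{A}_0(V)$. Let $\mathbb{F}$ be a non-archimedean real closed field of rank one extending $\mathbb{R}$, and let $\overline{V}$ be the extension of $V$ to $\mathbb{F}$. Then $$\mathcal{A}_0(V) = \mathcal{A}(\overline{V}).$$ If $\mathbb{F}$ extends $H(\overline{\mathbb{R}}^{\mathbb{R}})$, then $$\mathcal{A}(\overline{V}) = \mathrm{Log}(\overline{V}).$$
   Context: Logarithmic limit set: for $V\subset(\mathbb{R}_{>0})^n$ and $t\in(0,1)$ let $\mathrm{Log}_{1/t}(x_1,\dots,x_n)=(\log_{1/t}x_1,\dots,\log_{1/t}x_n)$ and $\mathcal{A}_t(V)=\mathrm{Log}_{1/t}(V)\subset\mathbb{R}^n$. For a family $(S_t)_{t\in(0,\varepsilon)}$ of subsets of $\mathbb{R}^n$, $\lim_{t\to0}S_t$ is the set of $y\in\mathbb{R}^n$ such that $(y,0)$ lies in the closure of $\{(x,t): x\in S_t\}$ in $\mathbb{R}^n\times[0,\varepsilon)$. Then $\mathcal{A}_0(V)=\lim_{t\to0}\mathcal{A}_t(V)$. Non-archimedean real closed field of rank one extending $\mathbb{R}$: a real closed field $\mathbb{F}\supset\mathbb{R}$ such that the valuation of $\mathbb{F}$ whose valuation ring is the convex hull of $\mathbb{R}$ in $\mathbb{F}$ has value group of rank one, i.e. isomorphic to a (nontrivial) ordered subgroup of $\mathbb{R}$. Such a field is equipped with a real-valued valuation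 $v:\mathbb{F}^*\to\mathbb{R}$ with this valuation ring (unique up to positive scaling; it is fixed by choosing $t\in\mathbb{F}$, $t>0$, $v(t)>0$, and normalizing $v(t)=1$). The extension $\overline{V}\subset(\mathbb{F}_{>0})^n$ is the set defined over $\mathbb{F}$ by a formula of the language of ordered rings, with real parameters, defining $V$. $\mathrm{Log}(\overline V)=\{(-v(h_1),\dots,-v(h_n)):h\in \overline V\}\subset\mathbb{R}^n$, and $\mathcal{A}(\overline V)$ is the closure of $\mathrm{Log}(\overline V)$ in $\mathbb{R}^n$. $\overline{\mathbb{R}}^{\mathbb{R}}$ is the ordered real field $(\mathbb{R},\le,+,\cdot)$ expanded by all real power functions (for each $\lambda\in\mathbb{R}$ the function equal to $x^\lambda$ for $x>0$ and $0$ for $x\le0$); it is o-minimal and polynomially bounded. Its Hardy field $H(\overline{\mathbb{R}}^{\mathbb{R}})$ is the real closed field of germs at $0^+$ of functions $\mathbb{R}_{>0}\to\mathbb{R}$ definable (with parameters) in $\overline{\mathbb{R}}^{\mathbb{R}}$, ordered by $[f]\le[g]$ iff $f(t)\le g(t)$ for all small $t>0$. *)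

(* Defs.v *)
From HB Require Import structures.
From mathcomp Require Import all_boot all_order all_algebra.
From mathcomp Require Import generic_quotient ring_quotient.
From mathcomp Require Import all_classical all_reals all_analysis.
From mathcomp Require Import ordered_qelim.

Set Implicit Arguments.
Unset Strict Implicit.
Unset Printing Implicit Defensive.

Import Order.TTheory GRing.Theory Num.Theory.
Import numFieldNormedType.Exports.

Local Open Scope classical_set_scope.
Local Open Scope ring_scope.

(** * Sets defined by formulas of ordered rings with parameters *)

(* [ord.formula K] has atoms [=], [<], [<=] between terms with constants in
   [K]; [ord.rformula] excludes the inverse and the unit test, leaving the
   language of ordered rings.  The variables ['X_0, ..., 'X_(n-1)] are the
   coordinates of [x]; any other free variable of [f] is read as [0]. *)
Definition defset (K : realDomainType) (n : nat) (f : ord.formula K) :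
    set 'rV[K]_n :=
  [set x | ord.holds [seq x ord0 i | i : 'I_n] f].

(* Boolean combinations of polynomial equalities and inequalities. *)
Definition semialgebraic (K : realDomainType) (n : nat) (V : set 'rV[K]_n) :
    Prop :=
  exists f : ord.formula K,
    [/\ ord.qf_form f, ord.rformula f & V = defset f].

Section MapFormula.
Variables (K L : Type) (iota : K -> L).

Fixpoint map_term (u : GRing.term K) : GRing.term L :=
  match u with
  | GRing.Var i => GRing.Var L i
  | GRing.Const c => GRing.Const (iota c)
  | GRing.NatConst m => GRing.NatConst L m
  | GRing.Add u1 u2 => GRing.Add (map_term u1) (map_term u2)
  | GRing.Opp u1 => GRing.Opp (map_term u1)
  | GRing.NatMul u1 m => GRing.NatMul (map_term u1) m
  | GRing.Mul u1 u2 => GRing.Mul (map_term u1) (map_term u2)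
  | GRing.Inv u1 => GRing.Inv (map_term u1)
  | GRing.Exp u1 m => GRing.Exp (map_term u1) m
  end.

Fixpoint map_formula (f : ord.formula K) : ord.formula L :=
  match f with
  | ord.Bool b => ord.Bool b
  | ord.Equal u1 u2 => ord.Equal (map_term u1) (map_term u2)
  | ord.Lt u1 u2 => ord.Lt (map_term u1) (map_term u2)
  | ord.Le u1 u2 => ord.Le (map_term u1) (map_term u2)
  | ord.Unit u1 => ord.Unit (map_term u1)
  | ord.And f1 f2 => ord.And (map_formula f1) (map_formula f2)
  | ord.Or f1 f2 => ord.Or (map_formula f1) (map_formula f2)
  | ord.Implies f1 f2 => ord.Implies (map_formula f1) (map_formula f2)
  | ord.Not f1 => ord.Not (map_formula f1)
  | ord.Exists i f1 => ord.Exists i (map_formula f1)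
  | ord.Forall i f1 => ord.Forall i (map_formula f1)
  end.

End MapFormula.

Definition extension (K L : realDomainType) (iota : K -> L) (n : nat)
    (f : ord.formula K) : set 'rV[L]_n :=
  defset (map_formula iota f).

Definition pos_orthant (K : realDomainType) (n : nat) : set 'rV[K]_n :=
  [set x | forall i, 0 < x ord0 i].

Definition rational_points (R : realType) (n : nat) : set 'rV[R]_n :=
  [set x | exists q : 'rV[rat]_n, x = map_mx ratr q].

(** * Logarithmic limit sets *)

Definition logb (R : realType) (b x : R) : R := ln x / ln b.

Definition amoeba (R : realType) (n : nat) (V : set 'rV[R]_n) (t : R) :
    set 'rV[R]_n :=
  map_mx (logb t^-1) @` V.

(* The closure is taken in [R^n * R]; at a point [(y, 0)] this is the same as
   the closure in the subspace [R^n * [0, eps)]. *)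
Definition lim_family (R : realType) (n : nat) (eps : R)
    (S : R -> set 'rV[R]_n) : set 'rV[R]_n :=
  [set y | closure [set p : 'rV[R]_n * R | 0 < p.2 < eps /\ S p.2 p.1] (y, 0)].

Definition log_limit_set (R : realType) (n : nat) (V : set 'rV[R]_n) :
    set 'rV[R]_n :=
  lim_family 1 (amoeba V).

(** * Real-valued valuations *)

(* [v] is only meaningful on nonzero elements, [v 0] is a junk value. *)
Record real_valuation (R : realType) (F : fieldType) (v : F -> R) : Prop :=
  RealValuation {
    val_mul : forall x y, x != 0 -> y != 0 -> v (x * y) = v x + v y;
    val_add : forall x y, x != 0 -> y != 0 -> x + y != 0 ->
      Num.min (v x) (v y) <= v (x + y)
  }.

Definition valuation_ring (R : realType) (F : fieldType) (v : F -> R) :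
    set F :=
  [set x | x = 0 \/ 0 <= v x].

Definition convex_hull_of (R : realType) (F : realFieldType) (iota : R -> F) :
    set F :=
  [set x | exists a b : R, iota a <= x <= iota b].

(* The natural valuation of a non-archimedean real field of rank one over [R],
   normalized by [v t = 1]: the order-embedding of the value group into the
   reals is part of [v], and [v t = 1] makes it nontrivial. *)
Definition rank_one_valuation (R : realType) (F : realFieldType)
    (iota : R -> F) (v : F -> R) (t : F) : Prop :=
  [/\ real_valuation v, valuation_ring v = convex_hull_of iota,
      0 < t & v t = 1].

Definition Log (R : realType) (F : fieldType) (v : F -> R) (n : nat)
    (W : set 'rV[F]_n) : set 'rV[R]_n :=
  map_mx (fun x => - v x) @` W.

(** * The Hardy field of the reals with real power functions *)

Section PowerStructure.
Variable R : realType.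

Definition power (lambda x : R) : R := if 0 < x then x `^ lambda else 0.

Inductive pow_term : Type :=
| PVar of nat
| PConst of R
| PAdd of pow_term & pow_term
| POpp of pow_term
| PMul of pow_term & pow_term
| PPow of R & pow_term.

(* De Bruijn indices: [PExists] binds the variable [0] of its argument. *)
Inductive pow_formula : Type :=
| PEq of pow_term & pow_term
| PLe of pow_term & pow_term
| PNot of pow_formula
| PAnd of pow_formula & pow_formula
| PExists of pow_formula.

Definition scons (x : R) (e : nat -> R) : nat -> R :=
  fun i => if i is j.+1 then e j else x.

Fixpoint pow_eval (e : nat -> R) (u : pow_term) : R :=
  match u with
  | PVar i => e i
  | PConst c => c
  | PAdd u1 u2 => pow_eval e u1 + pow_eval e u2
  | POpp u1 => - pow_eval e u1
  | PMul u1 u2 => pow_eval e u1 * pow_eval e u2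
  | PPow lambda u1 => power lambda (pow_eval e u1)
  end.

Fixpoint pow_holds (e : nat -> R) (f : pow_formula) : Prop :=
  match f with
  | PEq u1 u2 => pow_eval e u1 = pow_eval e u2
  | PLe u1 u2 => pow_eval e u1 <= pow_eval e u2
  | PNot f1 => ~ pow_holds e f1
  | PAnd f1 f2 => pow_holds e f1 /\ pow_holds e f2
  | PExists f1 => exists x, pow_holds (scons x e) f1
  end.

(* Functions on the positive reals are represented by functions on [R] whose
   values outside the positive reals are irrelevant. *)
Definition pow_definable (g : R -> R) : Prop :=
  exists f : pow_formula, forall x y,
    pow_holds (nth 0 [:: x; y]) f <-> 0 < x /\ y = g x.

Fixpoint ren_term (r : nat -> nat) (u : pow_term) : pow_term :=
  match u with
  | PVar i => PVar (r i)
  | PConst c => PConst c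
  | PAdd u1 u2 => PAdd (ren_term r u1) (ren_term r u2)
  | POpp u1 => POpp (ren_term r u1)
  | PMul u1 u2 => PMul (ren_term r u1) (ren_term r u2)
  | PPow lambda u1 => PPow lambda (ren_term r u1)
  end.

Definition up_ren (r : nat -> nat) (i : nat) : nat :=
  if i is j.+1 then (r j).+1 else 0%N.

Fixpoint ren_formula (r : nat -> nat) (f : pow_formula) : pow_formula :=
  match f with
  | PEq u1 u2 => PEq (ren_term r u1) (ren_term r u2)
  | PLe u1 u2 => PLe (ren_term r u1) (ren_term r u2)
  | PNot f1 => PNot (ren_formula r f1)
  | PAnd f1 f2 => PAnd (ren_formula r f1) (ren_formula r f2)
  | PExists f1 => PExists (ren_formula (up_ren r) f1)
  end.

Lemma ren_termP e r u : pow_eval e (ren_term r u) = pow_eval (e \o r) u.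
Proof. by elim: u => //= [u -> w -> | u -> | u -> w -> | l u ->]. Qed.

Lemma ren_formulaP e r f : pow_holds e (ren_formula r f) <-> pow_holds (e \o r) f.
Proof.
elim: f e r => /= [u w|u w|f IH|f1 IH1 f2 IH2|f IH] e r.
- by rewrite !ren_termP.
- by rewrite !ren_termP.
- by rewrite IH.
- by rewrite IH1 IH2.
have E x : scons x e \o up_ren r = scons x (e \o r).
  by apply/funext => -[].
by split=> -[x hx]; exists x; move: hx; rewrite IH E.
Qed.

Lemma pow_definable_cst (c : R) : pow_definable (cst c).
Proof.
exists (PAnd (PNot (PLe (PVar 0) (PConst 0))) (PEq (PVar 1) (PConst c))).
move=> x y /=; split=> -[h1 h2]; split => //.
  by rewrite ltNge; apply/negP.
by apply/negP; rewrite -ltNge.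
Qed.

Lemma pow_definable_op2 (op : R -> R -> R) (pop : pow_term -> pow_term -> pow_term)
    (popE : forall e u w, pow_eval e (pop u w) = op (pow_eval e u) (pow_eval e w))
    (g h : R -> R) :
  pow_definable g -> pow_definable h -> pow_definable (fun x => op (g x) (h x)).
Proof.
move=> [f hf] [k hk].
pose r (a i : nat) := match i with 0%N => 2%N | 1%N => a | _ => i.+2 end.
exists (PExists (PExists (PAnd (PAnd (ren_formula (r 1%N) f)
  (ren_formula (r 0%N) k)) (PEq (PVar 3) (pop (PVar 1) (PVar 0)))))).
move=> x y.
have E1 u w : scons w (scons u (nth 0 [:: x; y])) \o r 1%N = nth 0 [:: x; u].
  by apply/funext => -[|[|i]] //=; rewrite !nth_nil.
have E0 u w : scons w (scons u (nth 0 [:: x; y])) \o r 0%N = nth 0 [:: x; w].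
  by apply/funext => -[|[|i]] //=; rewrite !nth_nil.
split.
  move=> [u [w [[hu hw] hy]]].
  move/ren_formulaP: hu; rewrite E1 => /(hf x u).1 [x0 uE].
  move/ren_formulaP: hw; rewrite E0 => /(hk x w).1 [_ wE].
  by move: hy; rewrite /= popE /= uE wE.
move=> [x0 yE]; exists (g x), (h x); split; last by rewrite /= popE.
split; apply/ren_formulaP; first by rewrite E1; apply: (hf _ _).2.
by rewrite E0; apply: (hk _ _).2.
Qed.

Definition pow_definable_pred : {pred R -> R} := fun g => `[< pow_definable g >].

Lemma pow_definable_subring : subring_closed pow_definable_pred.
Proof.
split=> [|g h /asboolP hg /asboolP hh|g h /asboolP hg /asboolP hh]; apply/asboolP.
- exact: pow_definable_cst.
- exact: (@pow_definable_op2 (fun a b => a - b) (fun u w => PAdd u (POpp w))).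
- exact: (@pow_definable_op2 *%R PMul).
Qed.

HB.instance Definition _ :=
  GRing.isSubringClosed.Build (R -> R) pow_definable_pred pow_definable_subring.

Record definable_fun := DefinableFun {
  dfun :> R -> R;
  dfunP : dfun \in pow_definable_pred
}.

HB.instance Definition _ := [isSub for dfun].
HB.instance Definition _ := [Choice of definable_fun by <:].
HB.instance Definition _ :=
  [SubChoice_isSubComNzRing of definable_fun by <:].

Definition null_germ : {pred definable_fun} :=
  fun g => `[< \forall x \near 0^'+, g x = 0 >].

Lemma dfun0 x : (0 : definable_fun) x = 0.
Proof. by rewrite -[dfun 0]/(val 0) raddf0. Qed.

Lemma dfun1 x : (1 : definable_fun) x = 1.
Proof. by rewrite -[dfun 1]/(val 1) rmorph1. Qed.

Lemma dfunD (g h : definable_fun) x : (g + h) x = g x + h x.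
Proof. by rewrite -[dfun (g + h)]/(val (g + h)) raddfD. Qed.

Lemma dfunM (g h : definable_fun) x : (g * h) x = g x * h x.
Proof. by rewrite -[dfun (g * h)]/(val (g * h)) rmorphM. Qed.

Lemma null_germ_idealr : idealr_closed null_germ.
Proof.
split.
- by apply/asboolP; apply: nearW => x; rewrite dfun0.
- apply/negP => /asboolP h.
  have : \forall x \near (0 : R)^'+, False.
    by apply: filterS h => x /eqP; rewrite dfun1 oner_eq0.
  by move/filter_ex => -[].
- move=> a g h /asboolP hg /asboolP hh; apply/asboolP.
  apply: filterS2 hg hh => x gx hx.
  by rewrite dfunD dfunM gx hx mulr0 addr0.
Qed.

HB.instance Definition _ := isIdealr.Build definable_fun null_germ null_germ_idealr.

(* Germs at 0^+ of definable functions. *)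
Definition hardy : Type := {ideal_quot null_germ}.

Definition germ (g : definable_fun) : hardy :=
  (\pi_{ideal_quot null_germ} g)%qT.

Lemma germ_eqP (g h : definable_fun) :
  germ g = germ h <-> \forall x \near 0^'+, g x = h x.
Proof.
have -> : germ g = germ h <-> g - h \in null_germ.
  by rewrite Quotient.idealrBE; split=> /eqP.
have B x : (g - h) x = g x - h x.
  by rewrite -[dfun (g - h)]/(val (g - h)) raddfB.
split=> [/asboolP H|H]; last apply/asboolP; apply: filterS H => x.
  by rewrite B => /eqP; rewrite subr_eq0 => /eqP.
by rewrite B => ->; rewrite subrr.
Qed.

Definition germ_le (a b : hardy) : Prop :=
  exists g h : definable_fun, [/\ a = germ g, b = germ h &
    \forall x \near 0^'+, g x <= h x].

Definition cst_dfun (c : R) : definable_fun :=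
  DefinableFun (introT (asboolP _) (pow_definable_cst c)).

End PowerStructure.

(* [F] contains the Hardy field as an ordered extension of [R]. *)
Definition extends_hardy (R : realType) (F : realFieldType) (iota : R -> F) :
    Prop :=
  exists j : {rmorphism hardy R -> F},
    (forall a b, germ_le a b <-> j a <= j b) /\
    (forall c : R, j (germ (cst_dfun c)) = iota c).

(* Main.v *)
Require Import Defs.
From mathcomp Require Import all_boot all_order all_algebra.
From mathcomp Require Import all_classical all_reals all_analysis.
From mathcomp Require Import ordered_qelim ring lra.
From mathcomp Require qe_rcf qe_rcf_th.
Import Order.TTheory GRing.Theory Num.Theory.
Import numFieldNormedType.Exports.
Local Open Scope classical_set_scope.
Local Open Scope ring_scope.

Set Implicit Arguments.
Unset Strict Implicit.
Unset Printing Implicit Defensive.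

(** Everything follows from one statement about a point [y] of the logarithmic
limit set of [V].  Put [lam = - y].  For small [s > 0] the set [V] has points
[x] with [x_i = s ^ lam_i] up to factors [s ^ eps] and [s ^ (- eps)].  By
quantifier elimination, ``some [x] in [V] satisfies [z_i <= d * x_i] and
[x_i <= d * z_i] for all [i]'' is a Boolean combination of sign conditions on
finitely many polynomials in [z] and [d].  The sign of a polynomial is decided
by its dominant monomials, that is, by the order of the monomials up to a
bounded factor (lemma [dominant_sign]).  When [eps] is small compared to the
nonzero differences of the weights of the monomials in [z], the monomials at
[z = s ^ lam], [d = s ^ (- eps)] are ordered lexicographically: by their weight
in [z], then by their degree in [d].  They are ordered in the same way if [d] is
a large real constant [D].  So the sign conditions, which hold for
[d = s ^ (- eps)], still hold for [d = D].  Moreover, they hold for every [z],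
in every real closed field [L] over [R], whose monomials are ordered by the
weights [lam]: equal when their weights agree, and otherwise apart by a large
enough real factor.  Hence [V] has in [L] a point within the real factor [D] of
[z] (lemmas [near_point_two_scales] and [log_limit_near_point]).

Three choices of [z] give the theorem.

- Only finitely many monomials matter, and the equalities between their weights
  are linear equations in [lam] with integer coefficients.  The rational
  solutions are dense in the real ones, so [lam] may be replaced by a rational
  vector [q] close to it that orders the monomials in the same way
  ([rational_same_relations]).  Taking [z = s ^ q] in [R] shows that [- q] lies
  in the logarithmic limit set, whose rational points are therefore dense.
- Taking for [z] integral powers of an [N]-th root of [t] in [F], with valuation
  vector [q], gives a point of the extension of [V] with valuation vector [q].
  So [- q], hence also its limit [y], lies in the closure of [Log].
  Conversely, if [y] is minus the valuation vector of a point of the extension,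
  then for rationals [P_i / N < y_i < Q_i / N] the inequalities
  [t ^ (- P_i) < h_i ^ N < t ^ (- Q_i)] are first-order, and the real field
  satisfies them too, with [t] as small as desired ([Log_sub_log_limit]).
- If [F] contains the Hardy field, the germs of [s ^ (lam_i / kappa)] have
  valuation exactly [lam_i], where [kappa] is the valuation of the germ of the
  identity, and no approximation is needed: every point of the logarithmic limit
  set is minus a valuation vector ([log_limit_sub_Log]).

The transfer between [R] and its real closed extensions is Tarski's theorem in
the form [uniform_qe]: one quantifier-free formula over [R] is equivalent to the
given one in all real closed extensions of [R] at once. *)

(** * Naturality of the projection step of quantifier elimination *)

(** The projection algorithm [qe_rcf.wproj] is written in continuation-passing
style over the syntax of terms, and the only field constants that it adds to its
input are rational numbers.  So it commutes with the change of constants along a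
morphism [iota].
Each lemma below says this for one auxiliary function: if the continuations
correspond under [iota], so do the results. *)
Section Naturality.
Variables (R L : realFieldType) (iota : {rmorphism R -> L}).

Fixpoint qmap_term (u : qe_rcf.term R) : qe_rcf.term L :=
  match u with
  | qe_rcf.Var i => qe_rcf.Var L i
  | qe_rcf.Const c => qe_rcf.Const (iota c)
  | qe_rcf.NatConst m => qe_rcf.NatConst L m
  | qe_rcf.Add u1 u2 => qe_rcf.Add (qmap_term u1) (qmap_term u2)
  | qe_rcf.Opp u1 => qe_rcf.Opp (qmap_term u1)
  | qe_rcf.NatMul u1 m => qe_rcf.NatMul (qmap_term u1) m
  | qe_rcf.Mul u1 u2 => qe_rcf.Mul (qmap_term u1) (qmap_term u2)
  | qe_rcf.Exp u1 m => qe_rcf.Exp (qmap_term u1) m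
  end.

Fixpoint qmap_formula (f : qe_rcf.formula R) : qe_rcf.formula L :=
  match f with
  | qe_rcf.Bool b => qe_rcf.Bool b
  | qe_rcf.Equal u1 u2 => qe_rcf.Equal (qmap_term u1) (qmap_term u2)
  | qe_rcf.Lt u1 u2 => qe_rcf.Lt (qmap_term u1) (qmap_term u2)
  | qe_rcf.Le u1 u2 => qe_rcf.Le (qmap_term u1) (qmap_term u2)
  | qe_rcf.And f1 f2 => qe_rcf.And (qmap_formula f1) (qmap_formula f2)
  | qe_rcf.Or f1 f2 => qe_rcf.Or (qmap_formula f1) (qmap_formula f2)
  | qe_rcf.Implies f1 f2 => qe_rcf.Implies (qmap_formula f1) (qmap_formula f2)
  | qe_rcf.Not f1 => qe_rcf.Not (qmap_formula f1)
  end.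

Local Notation T := qmap_term.
Local Notation P := (map qmap_term).
Local Notation Q := qmap_formula.
Local Notation "k ~> k'" := (forall x, Q (k x) = k' x) (at level 70).

Lemma qmap_Size p k k' : k ~> k' -> Q (qe_rcf.Size p k) = qe_rcf.Size (P p) k'.
Proof.
elim: p k k' => [|c p IH] k k' kk' /=; first exact: kk'.
by apply: IH => -[|m] /=; rewrite !kk'.
Qed.

Lemma qmap_Isnull p k k' :
  k ~> k' -> Q (qe_rcf.Isnull p k) = qe_rcf.Isnull (P p) k'.
Proof. by move=> kk'; apply: qmap_Size => n; apply: kk'. Qed.

Lemma qmap_LtSize p q k k' :
  k ~> k' -> Q (qe_rcf.LtSize p q k) = qe_rcf.LtSize (P p) (P q) k'.
Proof.
by move=> kk'; apply: qmap_Size => n; apply: qmap_Size => m; apply: kk'.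
Qed.

Lemma qmap_LeadCoef p k k' : (forall x, Q (k x) = k' (T x)) ->
  Q (qe_rcf.LeadCoef p k) = qe_rcf.LeadCoef (P p) k'.
Proof.
elim: p k k' => [|c p IH] k k' kk' /=; first by rewrite kk' /= rmorph0.
by apply: IH => l; rewrite /= !kk'.
Qed.

Lemma qmap_AmulXn a n : P (qe_rcf.AmulXn a n) = qe_rcf.AmulXn (T a) n.
Proof. by elim: n => //= n ->; rewrite rmorph0. Qed.

Lemma qmap_AddPoly p q : P (qe_rcf.AddPoly p q) = qe_rcf.AddPoly (P p) (P q).
Proof. by elim: p q => //= a p IH [|b q] //=; rewrite IH. Qed.

Lemma qmap_ScalPoly c p : P (qe_rcf.ScalPoly c p) = qe_rcf.ScalPoly (T c) (P p).
Proof. by rewrite /qe_rcf.ScalPoly -!map_comp. Qed.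

Lemma qmap_MulPoly p q : P (qe_rcf.MulPoly p q) = qe_rcf.MulPoly (P p) (P q).
Proof. by elim: p => //= a p IH; rewrite qmap_AddPoly qmap_ScalPoly /= IH. Qed.

Lemma qmap_ExpPoly p n : P (qe_rcf.ExpPoly p n) = qe_rcf.ExpPoly (P p) n.
Proof.
case: n => // n; rewrite /qe_rcf.ExpPoly !iteropS.
by elim: n => //= n IH; rewrite qmap_MulPoly IH.
Qed.

Lemma qmap_OppPoly p : P (qe_rcf.OppPoly p) = qe_rcf.OppPoly (P p).
Proof. by rewrite /qe_rcf.OppPoly qmap_ScalPoly /= rmorphN1. Qed.

Lemma qmap_Deriv p : P (qe_rcf.Deriv p) = qe_rcf.Deriv (P p).
Proof. by elim: p => //= a p IH; rewrite qmap_AddPoly /= IH. Qed.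

Definition qmap_div (d : nat * qe_rcf.polyF R * qe_rcf.polyF R) :=
  (d.1.1, P d.1.2, P d.2).

Lemma qmap_Rediv_rec_loop q sq cq c qq r n k k' :
  (forall d, Q (k d) = k' (qmap_div d)) ->
  Q (qe_rcf.Rediv_rec_loop q sq cq c qq r n k) =
  qe_rcf.Rediv_rec_loop (P q) sq (T cq) c (P qq) (P r) n k'.
Proof.
move=> kk'; elim: n c qq r => [|n IH] c qq r /=; apply: qmap_Size => sr;
  case: ifP => _; rewrite ?kk' //; apply: qmap_LeadCoef => lr; rewrite ?IH ?kk';
  rewrite /qmap_div /=;
  by rewrite !(qmap_AddPoly, qmap_MulPoly, qmap_OppPoly, qmap_AmulXn).
Qed.

Lemma qmap_Rediv p q k k' : (forall d, Q (k d) = k' (qmap_div d)) ->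
  Q (qe_rcf.Rediv p q k) = qe_rcf.Rediv (P p) (P q) k'.
Proof.
move=> kk'; apply: qmap_Isnull => -[].
  by rewrite kk' /qmap_div /= rmorph0.
apply: qmap_Size => sq; apply: qmap_Size => sp; apply: qmap_LeadCoef => lq.
by rewrite (qmap_Rediv_rec_loop _ _ _ _ _ _ _ kk') /= rmorph0.
Qed.

Lemma qmap_Rmod p q k k' : (forall r, Q (k r) = k' (P r)) ->
  Q (qe_rcf.Rmod p q k) = qe_rcf.Rmod (P p) (P q) k'.
Proof. by move=> kk'; apply: qmap_Rediv => d; rewrite kk'. Qed.

Lemma qmap_Rscal p q k k' : k ~> k' ->
  Q (qe_rcf.Rscal p q k) = qe_rcf.Rscal (P p) (P q) k'.
Proof. by move=> kk'; apply: qmap_Rediv => d; rewrite kk'. Qed.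

Lemma qmap_Rgcd_loop n p q k k' : (forall r, Q (k r) = k' (P r)) ->
  Q (qe_rcf.Rgcd_loop n p q k) = qe_rcf.Rgcd_loop n (P p) (P q) k'.
Proof.
move=> kk'; elim: n p q => [|n IH] p q /=; apply: qmap_Rmod => r;
  by apply: qmap_Isnull => -[]; rewrite ?kk' ?IH.
Qed.

Lemma qmap_Rgcd p q k k' : (forall r, Q (k r) = k' (P r)) ->
  Q (qe_rcf.Rgcd p q k) = qe_rcf.Rgcd (P p) (P q) k'.
Proof.
move=> kk'; apply: qmap_LtSize => -[]; apply: qmap_Isnull => -[]; rewrite ?kk' //;
  by apply: qmap_Size => n; apply: qmap_Rgcd_loop.
Qed.

Lemma qmap_BigRgcd ps k k' : (forall r, Q (k r) = k' (P r)) ->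
  Q (qe_rcf.BigRgcd ps k) = qe_rcf.BigRgcd (map P ps) k'.
Proof.
elim: ps k k' => [|p ps IH] k k' kk' /=; first by rewrite kk' /= rmorph0.
by apply: IH => r; apply: qmap_Rgcd.
Qed.

Lemma qmap_Changes s k k' : k ~> k' ->
  Q (qe_rcf.Changes s k) = qe_rcf.Changes (P s) k'.
Proof.
elim: s k k' => [|a s IH] k k' kk' /=; first exact: kk'.
by apply: IH => v; rewrite /= !kk'; case: s.
Qed.

Lemma qmap_SeqPInfty ps k k' : (forall s, Q (k s) = k' (P s)) ->
  Q (qe_rcf.SeqPInfty ps k) = qe_rcf.SeqPInfty (map P ps) k'.
Proof.
elim: ps k k' => [|p ps IH] k k' kk' /=; first exact: kk'.
by apply: qmap_LeadCoef => l; apply: IH => s; rewrite kk'.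
Qed.

Lemma qmap_SeqMInfty ps k k' : (forall s, Q (k s) = k' (P s)) ->
  Q (qe_rcf.SeqMInfty ps k) = qe_rcf.SeqMInfty (map P ps) k'.
Proof.
elim: ps k k' => [|p ps IH] k k' kk' /=; first exact: kk'.
apply: qmap_LeadCoef => l; apply: qmap_Size => n; apply: IH => s.
by rewrite kk' /= rmorphN1.
Qed.

Lemma qmap_ChangesPoly ps k k' : k ~> k' ->
  Q (qe_rcf.ChangesPoly ps k) = qe_rcf.ChangesPoly (map P ps) k'.
Proof.
move=> kk'; apply: qmap_SeqMInfty => m; apply: qmap_SeqPInfty => p.
by apply: qmap_Changes => vm; apply: qmap_Changes => vp; apply: kk'.
Qed.

Lemma qmap_NextMod p q k k' : (forall r, Q (k r) = k' (P r)) ->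
  Q (qe_rcf.NextMod p q k) = qe_rcf.NextMod (P p) (P q) k'.
Proof.
move=> kk'; apply: qmap_LeadCoef => l; apply: qmap_Rscal => c.
by apply: qmap_Rmod => r; rewrite kk' qmap_ScalPoly.
Qed.

Lemma qmap_ModsAux p q n k k' : (forall s, Q (k s) = k' (map P s)) ->
  Q (qe_rcf.ModsAux p q n k) = qe_rcf.ModsAux (P p) (P q) n k'.
Proof.
elim: n p q k k' => [|n IH] p q k k' kk' /=; first exact: kk'.
apply: qmap_Isnull => -[]; first exact: kk'.
by apply: qmap_NextMod => r; apply: IH => s; rewrite kk'.
Qed.

Lemma qmap_Mods p q k k' : (forall s, Q (k s) = k' (map P s)) ->
  Q (qe_rcf.Mods p q k) = qe_rcf.Mods (P p) (P q) k'.
Proof.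
move=> kk'; apply: qmap_Size => m; apply: qmap_Size => n.
exact: qmap_ModsAux.
Qed.

Lemma nth_qmap (sq : seq (qe_rcf.polyF R)) i :
  nth [::] (map P sq) i = P (nth [::] sq i).
Proof.
have [lt_i|ge_i] := ltnP i (size sq); first by rewrite (nth_map [::]).
by rewrite !nth_default ?size_map.
Qed.

Lemma qmap_PolyComb sq sc :
  P (qe_rcf.PolyComb sq sc) = qe_rcf.PolyComb (map P sq) sc.
Proof.
rewrite /qe_rcf.PolyComb size_map /reducebig.
elim: (seq.iota _ _) => //= i s IH.
by rewrite qmap_MulPoly IH qmap_ExpPoly nth_qmap.
Qed.

Lemma qmap_Pcq sq i : P (qe_rcf.Pcq sq i) = qe_rcf.Pcq (map P sq) i.
Proof.
rewrite /qe_rcf.Pcq size_map -nth_qmap -map_comp; congr nth.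
by apply: eq_map => sc; exact: qmap_PolyComb.
Qed.

Lemma qmap_TaqR p q k k' : k ~> k' ->
  Q (qe_rcf.TaqR p q k) = qe_rcf.TaqR (P p) (P q) k'.
Proof.
move=> kk'; rewrite /qe_rcf.TaqR -qmap_Deriv -qmap_MulPoly.
by apply: qmap_Mods => r; apply: qmap_ChangesPoly.
Qed.

Lemma qmap_TaqsR p sq i k k' : (forall x, Q (k x) = k' (T x)) ->
  Q (qe_rcf.TaqsR p sq i k) = qe_rcf.TaqsR (P p) (map P sq) i k'.
Proof.
move=> kk'; rewrite /qe_rcf.TaqsR -qmap_Pcq; apply: qmap_TaqR => n.
by rewrite kk' /= rmorph_int.
Qed.

Lemma rmorph_nth (s : seq R) i : iota s`_i = (map iota s)`_i.
Proof.
have [lt_i|ge_i] := ltnP i (size s); first by rewrite (nth_map 0).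
by rewrite !nth_default ?size_map ?rmorph0.
Qed.

(** The coefficients of sign determination are entries of the inverse of an
integer matrix, and a field morphism commutes with matrix inversion. *)
Lemma rmorph_coefs n i : iota (qe_rcf_th.coefs R n i) = qe_rcf_th.coefs L n i.
Proof.
rewrite /qe_rcf_th.coefs; set s := map _ _; set s' := map _ _.
have -> : s' = map iota s.
  rewrite -map_comp; apply: eq_map => j /=.
  rewrite !castmxE /=; set A := qe_rcf_th.ctmat n.
  have -> : map_mx (intr : int -> L) A = map_mx iota (map_mx intr A).
    by rewrite -map_mx_comp; apply: eq_map_mx => z /=; rewrite rmorph_int.
  by rewrite -map_invmx mxE.
exact: rmorph_nth.
Qed.

Lemma qmap_Coefs n i : T (qe_rcf.Coefs R n i) = qe_rcf.Coefs L n i.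
Proof.
case: n => [|[|n]] /=; congr (qe_rcf.Const _).
- by rewrite rmorph_nat.
- case: i => [|[|[|i]]] /=; rewrite ?fmorphV ?rmorph_nat ?rmorph0 //.
  by rewrite !nth_nil rmorph0.
- exact: rmorph_coefs.
Qed.

Lemma qmap_CcountWeak p sq k k' : (forall x, Q (k x) = k' (T x)) ->
  Q (qe_rcf.CcountWeak p sq k) = qe_rcf.CcountWeak (P p) (map P sq) k'.
Proof.
move=> kk'; rewrite /qe_rcf.CcountWeak size_map.
have -> : qe_rcf.NatConst L 0 = T (qe_rcf.NatConst R 0) by [].
move: (qe_rcf.NatConst R 0); elim: (3 ^ _)%N k k' kk' => /= [|i IH] k k' kk' x.
  exact: kk'.
by apply: qmap_TaqsR => y; rewrite (IH _ _ kk') -qmap_Coefs.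
Qed.

Lemma qmap_BoundingPoly sq :
  P (qe_rcf.BoundingPoly sq) = qe_rcf.BoundingPoly (map P sq).
Proof.
rewrite /qe_rcf.BoundingPoly qmap_Deriv; congr qe_rcf.Deriv.
by elim: sq => //= q sq IH; rewrite qmap_MulPoly IH.
Qed.

Lemma qmap_CcountGt0 sp sq :
  Q (qe_rcf.CcountGt0 sp sq) = qe_rcf.CcountGt0 (map P sp) (map P sq).
Proof.
apply: qmap_BigRgcd => p; apply: qmap_Isnull => -[] /=; last first.
  by apply: qmap_CcountWeak.
rewrite -qmap_BoundingPoly; apply: qmap_CcountWeak => c /=.
congr (qe_rcf.Or _ (qe_rcf.Or _ _)).
  by elim: sq => //= q sq ->; congr (qe_rcf.And _ _); apply: qmap_LeadCoef.
elim: sq => //= q sq ->; congr (qe_rcf.And _ _).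
by apply: qmap_Size => n; apply: qmap_LeadCoef.
Qed.

Lemma qmap_abstrX i u : P (qe_rcf.abstrX i u) = qe_rcf.abstrX i (T u).
Proof.
elim: u => //=.
- by move=> n; case: ifP.
- by move=> u IHu w IHw; rewrite qmap_AddPoly IHu IHw.
- by move=> u IHu; rewrite qmap_OppPoly IHu.
- by move=> u IHu n; rewrite qmap_ScalPoly IHu.
- by move=> u IHu w IHw; rewrite qmap_MulPoly IHu IHw.
- by move=> u IHu n; rewrite qmap_ExpPoly IHu.
Qed.

Lemma qmap_to_rterm (u : GRing.term R) :
  T (qe_rcf.to_rterm u) = qe_rcf.to_rterm (map_term iota u).
Proof. by elim: u => //= [u -> w ->|u ->|u -> n|u -> w ->|u -> n]. Qed.

Definition map_clause (bc : seq (GRing.term R) * seq (GRing.term R)) :=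
  (map (map_term iota) bc.1, map (map_term iota) bc.2).

Lemma qmap_wproj i bc : Q (qe_rcf.wproj i bc) = qe_rcf.wproj i (map_clause bc).
Proof.
rewrite /qe_rcf.wproj qmap_CcountGt0 -!map_comp.
by congr qe_rcf.CcountGt0; apply: eq_map => u /=;
  rewrite qmap_abstrX qmap_to_rterm.
Qed.

Lemma map_rterm_to_term (u : qe_rcf.term R) :
  map_term iota (qe_rcf.rterm_to_term u) = qe_rcf.rterm_to_term (T u).
Proof. by elim: u => //= [u -> w ->|u ->|u -> n|u -> w ->|u -> n]. Qed.

Lemma map_qfr_to_formula (f : qe_rcf.formula R) :
  map_formula iota (qe_rcf.qfr_to_formula f) = qe_rcf.qfr_to_formula (Q f).
Proof.
by elim: f => //= [u w|u w|u w|f -> g ->|f -> g ->|f -> g ->|f ->] //;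
  rewrite !map_rterm_to_term.
Qed.

End Naturality.

(** * Uniform quantifier elimination *)

Section UniformQE.
Variable R : realFieldType.

Local Notation clause := (seq (GRing.term R) * seq (GRing.term R))%type.

(** A clause is a conjunction of the equations [u = 0], for [u] in its first
component, and the inequalities [0 < u], for [u] in its second component: the
input format of [qe_rcf.wproj]. *)
Definition clause_holds (L : realFieldType) (iota : R -> L) (e : seq L)
    (bc : clause) : bool :=
  all (fun u => GRing.eval e (map_term iota u) == 0) bc.1 &&
  all (fun u => 0 < GRing.eval e (map_term iota u)) bc.2.

Definition clause_rterm (bc : clause) : bool :=
  all (@GRing.rterm R) bc.1 && all (@GRing.rterm R) bc.2.

Lemma clauses_and (A B : seq clause) :
  all clause_rterm A -> all clause_rterm B ->
  exists2 C, all clause_rterm C &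
    forall (L : realFieldType) (iota : R -> L) e,
      has (clause_holds iota e) C =
      has (clause_holds iota e) A && has (clause_holds iota e) B.
Proof.
move=> rA rB; elim: A rA => [_|a A IH /= /andP[/andP[a1 a2] /IH[C rC CP]]].
  by exists [::].
exists ([seq (a.1 ++ b.1, a.2 ++ b.2) | b <- B] ++ C).
  rewrite all_cat rC andbT all_map; apply: sub_all rB => b /andP[b1 b2].
  by rewrite /= /clause_rterm /= !all_cat a1 a2 b1 b2.
move=> L iota e; rewrite has_cat CP /= andb_orl; congr (_ || _).
rewrite has_map; elim: (B) => [|b B1 /= ->]; first by rewrite andbF.
by rewrite andb_orr /clause_holds /= !all_cat andbACA.
Qed.

(** The disjunctive normal forms of a formula and of its negation are built
together, since each connective that involves a negation exchanges them. *)
Lemma qf_clauses (f : ord.formula R) : ord.qf_form f -> ord.rformula f ->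
  exists A B : seq clause, [/\ all clause_rterm A, all clause_rterm B &
    forall (L : realFieldType) (iota : R -> L) e,
      (ord.holds e (map_formula iota f) <-> has (clause_holds iota e) A) /\
      has (clause_holds iota e) B = ~~ has (clause_holds iota e) A].
Proof.
have and2 := clauses_and.
elim: f => //=.
- move=> b _ _; exists (if b then [:: ([::], [::])] else [::]).
  by exists (if b then [::] else [:: ([::], [::])]); split; case: b.
- move=> u w _ /andP[ru rw].
  exists [:: ([:: GRing.Add u (GRing.Opp w)], [::])].
  exists [:: ([::], [:: GRing.Add u (GRing.Opp w)]);
             ([::], [:: GRing.Add w (GRing.Opp u)])].
  rewrite /clause_rterm /= ru rw; split => // L iota e.
  rewrite /clause_holds /= !andbT !orbF subr_eq0 !subr_gt0.
  by split; [split=> /eqP | case: ltgtP].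
- move=> u w _ /andP[ru rw].
  exists [:: ([::], [:: GRing.Add w (GRing.Opp u)])].
  exists [:: ([::], [:: GRing.Add u (GRing.Opp w)]);
             ([:: GRing.Add u (GRing.Opp w)], [::])].
  rewrite /clause_rterm /= ru rw; split => // L iota e.
  rewrite /clause_holds /= !andbT !orbF subr_eq0 !subr_gt0.
  by split=> //; case: ltgtP.
- move=> u w _ /andP[ru rw].
  exists [:: ([::], [:: GRing.Add w (GRing.Opp u)]);
             ([:: GRing.Add u (GRing.Opp w)], [::])].
  exists [:: ([::], [:: GRing.Add u (GRing.Opp w)])].
  rewrite /clause_rterm /= ru rw; split => // L iota e.
  rewrite /clause_holds /= !andbT !orbF subr_eq0 !subr_gt0.
  by case: ltgtP => // ->; rewrite ltxx.
- move=> f IHf g IHg /andP[/IHf{}IHf /IHg{}IHg] /andP[/IHf[A [B [rA rB fP]]]].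
  move=> /IHg[A' [B' [rA' rB' gP]]].
  have [C rC CP] := and2 _ _ rA rA'; exists C, (B ++ B').
  rewrite all_cat rB rB'; split => // L iota e.
  have [fP1 fP2] := fP L iota e; have [gP1 gP2] := gP L iota e.
  rewrite CP has_cat fP2 gP2 negb_and; split => //.
  by rewrite fP1 gP1; split => [[-> ->]|/andP].
- move=> f IHf g IHg /andP[/IHf{}IHf /IHg{}IHg] /andP[/IHf[A [B [rA rB fP]]]].
  move=> /IHg[A' [B' [rA' rB' gP]]].
  have [C rC CP] := and2 _ _ rB rB'; exists (A ++ A'), C.
  rewrite all_cat rA rA'; split => // L iota e.
  have [fP1 fP2] := fP L iota e; have [gP1 gP2] := gP L iota e.
  rewrite CP has_cat fP2 gP2 negb_or; split => //.
  by rewrite fP1 gP1; split => /orP.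
- move=> f IHf g IHg /andP[/IHf{}IHf /IHg{}IHg] /andP[/IHf[A [B [rA rB fP]]]].
  move=> /IHg[A' [B' [rA' rB' gP]]].
  have [C rC CP] := and2 _ _ rA rB'; exists (B ++ A'), C.
  rewrite all_cat rB rA'; split => // L iota e.
  have [fP1 fP2] := fP L iota e; have [gP1 gP2] := gP L iota e.
  rewrite CP has_cat fP2 gP2 negb_or negbK; split => //.
  by rewrite fP1 gP1 -implybE; split => /implyP.
- move=> f IHf /IHf{}IHf /IHf[A [B [rA rB fP]]]; exists B, A; split=> // L iota e.
  have [fP1 fP2] := fP L iota e; rewrite fP2 negbK; split => //.
  by rewrite fP1; split => /negP.
Qed.

Lemma clause_holds_odnf (L : realFieldType) (iota : R -> L) e (bc : clause) :
  ord.holds e (ord.odnf_to_oform [:: ord.w_to_oclause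
    (map (map_term iota) bc.1, map (map_term iota) bc.2)]) <->
  clause_holds iota e bc.
Proof.
rewrite /clause_holds /=; case: bc => A B /=.
have -> : ord.holds e (foldr (fun t => ord.And (ord.Equal t (GRing.NatConst _ 0)))
    (ord.Bool true) (map (map_term iota) A)) <->
    all (fun u => GRing.eval e (map_term iota u) == 0) A.
  elim: A => //= u A ->; split => [[-> ->]|/andP[/eqP -> ->]] //.
  by rewrite eqxx.
have -> : ord.holds e (foldr (fun t => ord.And (ord.Lt (GRing.NatConst _ 0) t))
    (ord.Bool true) (map (map_term iota) B)) <->
    all (fun u => 0 < GRing.eval e (map_term iota u)) B.
  by elim: B => //= u B ->; split => [[-> ->]|/andP[-> ->]].
by split => [[|//] [-> [_ [->]]]|/andP[-> ->]] //; left.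
Qed.

(** Over [L], the projection of the transported clauses is correct; by naturality
it is the transport of the projection over [R], which does not depend on [L]. *)
Lemma exists_elim (i : nat) (A : seq clause) : all clause_rterm A ->
  exists g : ord.formula R, [/\ ord.qf_form g, ord.rformula g &
    forall (L : rcfType) (iota : {rmorphism R -> L}) e,
      (exists x, has (clause_holds iota (set_nth 0 e i x)) A) <->
      ord.holds e (map_formula iota g)].
Proof.
elim: A => [_|bc A IH /= /andP[/andP[rbc1 rbc2] /IH[g [qg rg gP]]]].
  exists (ord.Bool false); split=> // L iota e; split=> // -[x //].
exists (ord.Or (qe_rcf.qfr_to_formula (qe_rcf.wproj i bc)) g).
rewrite /= qe_rcf.qf_formF qe_rcf.rformulaF qg rg; split=> // L iota e.
rewrite map_qfr_to_formula qmap_wproj -gP.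
have r_bc : ord.dnf_rterm (ord.w_to_oclause (map_clause iota bc)).
  rewrite /ord.dnf_rterm /= !all_map andbT; apply/andP; split.
    by apply: sub_all rbc1 => u /=; elim: u => //= u IHu w IHw /andP[/IHu -> /IHw].
  by apply: sub_all rbc2 => u /=; elim: u => //= u IHu w IHw /andP[/IHu -> /IHw].
have /= H := qe_rcf.valid_QE_wproj i e r_bc.
have {}H : ord.holds e (qe_rcf.qfr_to_formula (qe_rcf.wproj i (map_clause iota bc)))
    <-> exists x, clause_holds iota (set_nth 0 e i x) bc.
  have E := ord.qf_evalP e (qe_rcf.qf_formF (qe_rcf.wproj i (map_clause iota bc))).
  split=> [/E/H[x /clause_holds_odnf xP]|[x /clause_holds_odnf xP]].
    by exists x.
  by apply/E/H; exists x.
rewrite H; split=> [[x /orP[xP|xP]]|[[x xP]|[x xP]]].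
- by left; exists x.
- by right; exists x.
- by exists x; rewrite xP.
- by exists x; rewrite xP orbT.
Qed.

(** The formula [g] is chosen before [L]: this is what lets sign conditions
found over the reals be used in an extension. *)
Lemma uniform_qe (f : ord.formula R) : ord.rformula f ->
  exists g : ord.formula R, [/\ ord.qf_form g, ord.rformula g &
    forall (L : rcfType) (iota : {rmorphism R -> L}) e,
      ord.holds e (map_formula iota f) <-> ord.holds e (map_formula iota g)].
Proof.
elim: f => //=.
- by move=> b _; exists (ord.Bool b).
- by move=> u w r; exists (ord.Equal u w).
- by move=> u w r; exists (ord.Lt u w).
- by move=> u w r; exists (ord.Le u w).
- move=> f IHf g IHg /andP[/IHf[f' [qf rf fP]] /IHg[g' [qg rg gP]]].
  exists (ord.And f' g'); rewrite /= qf rf qg rg; split=> // L iota e.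
  by rewrite fP gP.
- move=> f IHf g IHg /andP[/IHf[f' [qf rf fP]] /IHg[g' [qg rg gP]]].
  exists (ord.Or f' g'); rewrite /= qf rf qg rg; split=> // L iota e.
  by rewrite fP gP.
- move=> f IHf g IHg /andP[/IHf[f' [qf rf fP]] /IHg[g' [qg rg gP]]].
  exists (ord.Implies f' g'); rewrite /= qf rf qg rg; split=> // L iota e.
  by rewrite fP gP.
- move=> f IHf /IHf[f' [qf rf fP]].
  by exists (ord.Not f'); split=> // L iota e; rewrite /= fP.
- move=> i f IHf /IHf[f' [qf rf fP]].
  have [A [B [rA _ AP]]] := qf_clauses qf rf.
  have [g [qg rg gP]] := exists_elim i rA.
  exists g; split=> // L iota e; rewrite -gP.
  by split=> -[x xP]; exists x; move: xP; rewrite fP (AP _ _ _).1.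
- move=> i f IHf /IHf[f' [qf rf fP]].
  have [A [B [_ rB AP]]] := qf_clauses qf rf.
  have [g [qg rg gP]] := exists_elim i rB.
  exists (ord.Not g); split=> // L iota e; rewrite /= -gP.
  split=> [fx [x]|Bx x].
    by rewrite (AP _ _ _).2 => /negP; apply; apply/(AP _ _ _).1/fP/fx.
  apply/fP/(AP _ _ _).1/negPn/negP => nA; apply: Bx; exists x.
  by rewrite (AP _ _ _).2.
Qed.

End UniformQE.

Lemma map_term_id (K : Type) (u : GRing.term K) : map_term id u = u.
Proof. by elim: u => //= [u -> w ->|u ->|u -> n|u -> w ->|u ->|u -> n]. Qed.

Lemma map_formula_id (K : Type) (f : ord.formula K) : map_formula id f = f.
Proof.
by elim: f => //= [u w|u w|u w|u|f -> g ->|f -> g ->|f -> g ->|f ->|i f ->|i f ->];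
  rewrite ?map_term_id.
Qed.

(** Nonnegative elements of a real closed field are squares. *)
Lemma rcf_morph_mono (R : rcfType) (L : realFieldType) (iota : {rmorphism R -> L}) :
  {mono iota : x y / x <= y}.
Proof.
have pos x : 0 <= x -> 0 <= iota x.
  by move=> /sqr_sqrtr <-; rewrite rmorphXn sqr_ge0.
move=> x y; have [le_xy|lt_yx] := leP x y.
  by rewrite -subr_ge0 -rmorphB pos ?subr_ge0.
apply/negbTE; rewrite -ltNge lt_def -subr_ge0 -rmorphB pos ?subr_ge0 ?ltW //.
by rewrite andbT (inj_eq (fmorph_inj iota)) eq_sym lt_eqF.
Qed.

Lemma rmorph_eval (R L : realFieldType) (iota : {rmorphism R -> L}) e u :
  GRing.rterm u -> iota (GRing.eval e u) =
  GRing.eval (map iota e) (map_term iota u).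
Proof.
elim: u => //=.
- by move=> i _; exact: rmorph_nth.
- by move=> n _; rewrite rmorph_nat.
- by move=> u IHu w IHw /andP[/IHu <- /IHw <-]; rewrite rmorphD.
- by move=> u IHu /IHu <-; rewrite rmorphN.
- by move=> u IHu n /IHu <-; rewrite rmorphMn.
- by move=> u IHu w IHw /andP[/IHu <- /IHw <-]; rewrite rmorphM.
- by move=> u IHu n /IHu <-; rewrite rmorphXn.
Qed.

(** Quantifier-free formulas keep their truth value along an ordered field
morphism, so quantifier elimination makes every such morphism between real
closed fields elementary. *)
Lemma rcf_elementary (R L : rcfType) (iota : {rmorphism R -> L})
    (f : ord.formula R) e : ord.rformula f ->
  ord.holds e f <-> ord.holds (map iota e) (map_formula iota f).
Proof.
move=> /uniform_qe[g [qg rg gP]].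
rewrite gP -{1}[f]map_formula_id (gP _ idfun) map_formula_id.
have mono := rcf_morph_mono iota.
elim: g {gP} qg rg => //=.
- move=> u w _ /andP[ru rw]; rewrite -!rmorph_eval //.
  by split => [->//|/fmorph_inj].
- move=> u w _ /andP[ru rw]; rewrite -!rmorph_eval //.
  by rewrite (leW_mono mono).
- by move=> u w _ /andP[ru rw]; rewrite -!rmorph_eval // mono.
- by move=> f1 IH1 f2 IH2 /andP[/IH1{}IH1 /IH2{}IH2] /andP[/IH1 -> /IH2 ->].
- by move=> f1 IH1 f2 IH2 /andP[/IH1{}IH1 /IH2{}IH2] /andP[/IH1 -> /IH2 ->].
- by move=> f1 IH1 f2 IH2 /andP[/IH1{}IH1 /IH2{}IH2] /andP[/IH1 -> /IH2 ->].
- by move=> f1 IH1 /IH1{}IH1 /IH1 ->.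
Qed.

(** * Signs of polynomials and dominant monomials *)

Definition monomial (L : realFieldType) (m : nat) (z : 'I_m -> L)
    (a : {ffun 'I_m -> nat}) : L := \prod_i z i ^+ a i.

Definition poly_value (R L : realFieldType) (iota : R -> L) (m : nat)
    (z : 'I_m -> L) (l : seq (R * {ffun 'I_m -> nat})) : L :=
  \sum_(p <- l) iota p.1 * monomial z p.2.

(** An environment whose first [off] variables are switched off.  These are the
places of the variables eliminated from a formula, whose indices remain below
those of the parameters [z]. *)
Definition zeros_then (L : realFieldType) (off m : nat) (z : 'I_m -> L) : seq L :=
  nseq off 0 ++ [seq z i | i : 'I_m].

Lemma nth_codom_ord (L : realFieldType) (m : nat) (z : 'I_m -> L) (i : 'I_m) :
  [seq z j | j : 'I_m]`_i = z i.
Proof. by rewrite (nth_map i) ?nth_ord_enum // size_enum_ord. Qed.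

Lemma nth_zeros_then (L : realFieldType) (off m : nat) (z : 'I_m -> L) (i : 'I_m) :
  (zeros_then off z)`_(off + i) = z i.
Proof.
by rewrite /zeros_then nth_cat size_nseq ltnNge leq_addr addKn nth_codom_ord.
Qed.

Definition expD (m : nat) (a b : {ffun 'I_m -> nat}) : {ffun 'I_m -> nat} :=
  [ffun i => (a i + b i)%N].

Lemma monomialD (L : realFieldType) m (z : 'I_m -> L) (a b : {ffun 'I_m -> nat}) :
  monomial z (expD a b) = monomial z a * monomial z b.
Proof.
by rewrite /monomial -big_split; apply: eq_bigr => i _; rewrite ffunE exprD.
Qed.

Lemma monomial0 (L : realFieldType) m (z : 'I_m -> L) :
  monomial z [ffun => 0%N] = 1.
Proof. by rewrite /monomial big1 // => i _; rewrite ffunE. Qed.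

Lemma monomial_gt0 (L : realFieldType) m (z : 'I_m -> L) a :
  (forall i, 0 < z i) -> 0 < monomial z a.
Proof. by move=> z0; apply: prodr_gt0 => i _; apply: exprn_gt0. Qed.

Lemma poly_valueM (R : realFieldType) m (l1 l2 : seq (R * {ffun 'I_m -> nat})) :
  exists l, forall (L : realFieldType) (iota : {rmorphism R -> L}) z,
    poly_value iota z l = poly_value iota z l1 * poly_value iota z l2.
Proof.
exists [seq (p.1 * q.1, expD p.2 q.2) | p <- l1, q <- l2].
move=> L iota z; rewrite /poly_value big_allpairs_dep big_distrl /=.
apply: eq_bigr => p _; rewrite big_distrr /=; apply: eq_bigr => q _.
by rewrite rmorphM monomialD mulrACA.
Qed.

Lemma term_poly_value (R : realFieldType) (off m : nat) (u : GRing.term R) :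
  GRing.rterm u -> exists l : seq (R * {ffun 'I_m -> nat}),
    forall (L : realFieldType) (iota : {rmorphism R -> L}) z,
      GRing.eval (zeros_then off z) (map_term iota u) = poly_value iota z l.
Proof.
have cst (c : R) : exists l : seq (R * {ffun 'I_m -> nat}),
    forall (L : realFieldType) (iota : {rmorphism R -> L}) z,
      iota c = poly_value iota z l.
  exists [:: (c, [ffun => 0%N])] => L iota z.
  by rewrite /poly_value big_seq1 monomial0 mulr1.
elim: u => //=.
- move=> i _; have [lt_i|ge_i] := ltnP i off.
    exists [::] => L iota z; rewrite /poly_value big_nil /zeros_then.
    by rewrite nth_cat size_nseq lt_i nth_nseq if_same.
  have [lt_im|ge_im] := ltnP (i - off) m; last first.
    exists [::] => L iota z; rewrite /poly_value big_nil nth_default //.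
    by rewrite size_cat size_nseq size_map size_enum_ord -leq_subRL.
  pose j := Ordinal lt_im; exists [:: (1, [ffun k => (k == j : nat)])] => L iota z.
  rewrite -(subnKC ge_i) (nth_zeros_then off z j).
  rewrite /poly_value big_seq1 /= rmorph1 mul1r /monomial (bigD1 j) //= ffunE eqxx.
  by rewrite big1 ?mulr1 // => k /negbTE kj; rewrite ffunE kj.
- by move=> n _; have [l lP] := cst n%:R; exists l => L iota z;
    rewrite -lP rmorph_nat.
- move=> u IHu w IHw /andP[/IHu[l1 l1P] /IHw[l2 l2P]].
  exists (l1 ++ l2) => L iota z.
  by rewrite /poly_value big_cat l1P l2P.
- move=> u IHu /IHu[l lP]; exists [seq (- p.1, p.2) | p <- l] => L iota z.
  rewrite lP /poly_value big_map -sumrN.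
  by apply: eq_bigr => p _; rewrite /= rmorphN mulNr.
- move=> u IHu n /IHu[l lP]; exists [seq (p.1 *+ n, p.2) | p <- l] => L iota z.
  rewrite lP /poly_value big_map -sumrMnl.
  by apply: eq_bigr => p _; rewrite /= rmorphMn mulrnAl.
- move=> u IHu w IHw /andP[/IHu[l1 l1P] /IHw[l2 l2P]].
  have [l lP] := poly_valueM l1 l2; exists l => L iota z.
  by rewrite lP l1P l2P.
- move=> u IHu n /IHu[l lP].
  elim: n => [|n [ln lnP]].
    by have [l1 l1P] := cst 1; exists l1 => L iota z; rewrite -l1P rmorph1.
  have [l' l'P] := poly_valueM l ln; exists l' => L iota z.
  by rewrite exprS lnP lP l'P.
Qed.

(** A quantifier-free formula is a Boolean combination of sign conditions, so it
cannot distinguish two points, possibly of different fields, at which the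
polynomials compared in it have equal signs. *)
Lemma qf_sign_polys (R : realFieldType) (off m : nat) (g : ord.formula R) :
  ord.qf_form g -> ord.rformula g ->
  exists ls : seq (seq (R * {ffun 'I_m -> nat})),
    forall (L1 L2 : realFieldType) (iota1 : {rmorphism R -> L1})
      (iota2 : {rmorphism R -> L2}) z1 z2,
      {in ls, forall l, sgz (poly_value iota1 z1 l) = sgz (poly_value iota2 z2 l)} ->
      ord.holds (zeros_then off z1) (map_formula iota1 g) <->
      ord.holds (zeros_then off z2) (map_formula iota2 g).
Proof.
have atom u w : GRing.rterm u && GRing.rterm w ->
    exists l : seq (R * {ffun 'I_m -> nat}),
    forall (L : realFieldType) (iota : {rmorphism R -> L}) z,
      GRing.eval (zeros_then off z) (map_term iota u) -
      GRing.eval (zeros_then off z) (map_term iota w) = poly_value iota z l.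
  move=> /andP[ru rw].
  have [|l lP] := @term_poly_value R off m (GRing.Add u (GRing.Opp w)).
    by rewrite /= ru rw.
  by exists l => L iota z; rewrite -lP.
elim: g => //=.
- by exists [::].
- move=> u w _ /atom[l lP]; exists [:: l] => L1 L2 i1 i2 z1 z2 /(_ _ (mem_head _ _)).
  rewrite -!lP => E.
  split=> /eqP; rewrite -subr_eq0 -sgz_eq0.
    by rewrite E sgz_eq0 subr_eq0 => /eqP.
  by rewrite -E sgz_eq0 subr_eq0 => /eqP.
- move=> u w _ /atom[l lP]; exists [:: l] => L1 L2 i1 i2 z1 z2 /(_ _ (mem_head _ _)).
  rewrite -!lP => E; split; rewrite -subr_lt0 -sgz_lt0.
    by rewrite E sgz_lt0 subr_lt0.
  by rewrite -E sgz_lt0 subr_lt0.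
- move=> u w _ /atom[l lP]; exists [:: l] => L1 L2 i1 i2 z1 z2 /(_ _ (mem_head _ _)).
  rewrite -!lP => E; split; rewrite -subr_le0 -sgz_le0.
    by rewrite E sgz_le0 subr_le0.
  by rewrite -E sgz_le0 subr_le0.
- move=> f IHf g IHg /andP[/IHf{}IHf /IHg{}IHg] /andP[/IHf[A AP] /IHg[B BP]].
  exists (A ++ B) => L1 L2 i1 i2 z1 z2 E; rewrite (AP _ L2 _ i2 _ z2) ?(BP _ L2 _ i2 _ z2) //.
    by move=> l lB; apply: E; rewrite mem_cat lB orbT.
  by move=> l lB; apply: E; rewrite mem_cat lB.
- move=> f IHf g IHg /andP[/IHf{}IHf /IHg{}IHg] /andP[/IHf[A AP] /IHg[B BP]].
  exists (A ++ B) => L1 L2 i1 i2 z1 z2 E; rewrite (AP _ L2 _ i2 _ z2) ?(BP _ L2 _ i2 _ z2) //.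
    by move=> l lB; apply: E; rewrite mem_cat lB orbT.
  by move=> l lB; apply: E; rewrite mem_cat lB.
- move=> f IHf g IHg /andP[/IHf{}IHf /IHg{}IHg] /andP[/IHf[A AP] /IHg[B BP]].
  exists (A ++ B) => L1 L2 i1 i2 z1 z2 E; rewrite (AP _ L2 _ i2 _ z2) ?(BP _ L2 _ i2 _ z2) //.
    by move=> l lB; apply: E; rewrite mem_cat lB orbT.
  by move=> l lB; apply: E; rewrite mem_cat lB.
- move=> f IHf /IHf{}IHf /IHf[A AP]; exists A => L1 L2 i1 i2 z1 z2 E.
  by rewrite (AP _ L2 _ i2 _ z2).
Qed.

(** [T a] stands for the value of the monomial [a].  The monomials of least weight
have a common value; if their coefficients do not add up to 0, they dominate
all the others and the sign of the sum is that of the sum of these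
coefficients.  Otherwise they cancel out and can be removed, which leaves a
shorter sum.  Neither [delta] nor the sign depends on the field [L] or on
[T]. *)
Lemma dominant_sign (R : rcfType) (I : eqType) (l : seq (R * I)) (w : I -> R) :
  exists2 delta : R, 0 < delta & exists sigma : int,
    forall (L : realFieldType) (iota : {rmorphism R -> L}) (T : I -> L),
      {in map snd l, forall a, 0 < T a} ->
      {in map snd l &, forall a b, w a = w b -> T a = T b} ->
      {in map snd l &, forall a b, w a < w b -> T b <= iota delta * T a} ->
      sgz (\sum_(p <- l) iota p.1 * T p.2) = sigma.
Proof.
have [N] := ubnP (size l); elim: N l => // N IH [|p0 l0] sz_l.
  by exists 1 => //; exists 0 => L iota T _ _ _; rewrite big_nil sgz0.
have : p0 :: l0 != [::] by [].
move: (p0 :: l0) sz_l => {p0 l0} l sz_l l_n0.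
have [p1 p1l p1min] : exists2 p1, p1 \in l & {in l, forall p, w p1.2 <= w p.2}.
  elim: (l) l_n0 => // p s IHs _; have [->|/IHs[q qs qmin]] := eqVneq s [::].
    by exists p; rewrite ?mem_head // => q; rewrite inE => /eqP ->.
  have [le_pq|lt_qp] := leP (w p.2) (w q.2).
    exists p; rewrite ?mem_head // => r; rewrite inE => /orP[/eqP -> //|/qmin].
    exact: le_trans.
  exists q; first by rewrite inE qs orbT.
  by move=> r; rewrite inE => /orP[/eqP ->|/qmin //]; apply: ltW.
pose top (p : R * I) := w p.2 == w p1.2.
pose C := \sum_(p <- l | top p) p.1.
have split_sum (L : realFieldType) (iota : {rmorphism R -> L}) (T : I -> L) :
    {in map snd l &, forall a b, w a = w b -> T a = T b} ->
    \sum_(p <- l) iota p.1 * T p.2 =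
    iota C * T p1.2 + \sum_(p <- [seq p <- l | ~~ top p]) iota p.1 * T p.2.
  move=> Teq; rewrite [LHS](bigID top) /= [in RHS]big_filter; congr (_ + _).
  rewrite rmorph_sum big_distrl /= big_seq_cond [RHS]big_seq_cond.
  apply: eq_bigr => p /andP[pl /eqP wp].
  by rewrite (Teq p.2 p1.2) // map_f.
have [C0|Cn0] := eqVneq C 0.
  have [|delta d0 [sigma sP]] := IH [seq p <- l | ~~ top p].
    rewrite ltnS in sz_l; apply: leq_trans sz_l; rewrite size_filter -(count_predC top l).
    rewrite -[X in (X < _)%N]add0n ltn_add2r -has_count; apply/hasP.
    by exists p1; rewrite // /top eqxx.
  have sub : {subset map snd [seq p <- l | ~~ top p] <= map snd l}.
    by move=> _ /mapP[p + ->]; rewrite mem_filter => /andP[_ /(map_f snd)].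
  exists delta => //; exists sigma => L iota T T0 Teq Tlt.
  rewrite split_sum // C0 rmorph0 mul0r add0r; apply: sP.
  - by move=> a /sub /T0.
  - by move=> a b /sub al /sub bl; apply: Teq.
  - by move=> a b /sub al /sub bl; apply: Tlt.
pose S := \sum_(p <- [seq p <- l | ~~ top p]) `|p.1|.
have S0 : 0 < S + 1 by rewrite ltr_wpDl // sumr_ge0.
(* The other terms add up to at most S * delta times the value of the leading
   monomial, so delta must satisfy S * delta < `|C|. *)
exists (`|C| / (2 * (S + 1))).
  by rewrite divr_gt0 ?normr_gt0 // mulr_gt0.
exists (sgz C) => L iota T T0 Teq Tlt.
set delta := `|C| / _ in Tlt.
have mono := rcf_morph_mono iota.
have norm_iota x : iota `|x| = `|iota x|.
  have [x0|x0] := leP 0 x; first by rewrite !ger0_norm // -(rmorph0 iota) mono.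
  by rewrite !ltr0_norm ?rmorphN // -(rmorph0 iota) (leW_mono mono).
have sgz_iota x : sgz (iota x) = sgz x.
  have [x0|x0|->] := ltgtP x 0; last by rewrite rmorph0 !sgz0.
    by rewrite !ltr0_sgz // -(rmorph0 iota) (leW_mono mono).
  by rewrite !gtr0_sgz // -(rmorph0 iota) (leW_mono mono).
have T1 : 0 < T p1.2 by apply: T0; rewrite map_f.
rewrite split_sum //; set B := \sum_(p <- _) _.
have B_small : `|B| < `|iota C * T p1.2|.
  apply: (@le_lt_trans _ _ (iota (S * delta) * T p1.2)).
    rewrite /S rmorphM rmorph_sum !big_distrl /=.
    apply: le_trans (ler_norm_sum _ _ _) _; rewrite big_seq [leRHS]big_seq.
    apply: ler_sum => p; rewrite mem_filter => /andP[ntop pl].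
    have Tp : 0 < T p.2 by apply: T0; rewrite map_f.
    rewrite normrM norm_iota (gtr0_norm Tp) -mulrA ler_wpM2l //.
    by apply: Tlt; rewrite ?map_f // lt_def ntop p1min.
  rewrite normrM (gtr0_norm T1) ltr_pM2r // -norm_iota (leW_mono mono).
  rewrite /delta mulrCA -[ltRHS]mulr1 ltr_pM2l ?normr_gt0 //.
  by rewrite ltr_pdivrMr ?mulr_gt0 // mul1r; lra.
rewrite -(sgz_iota C); have : iota C * T p1.2 != 0.
  by rewrite mulf_neq0 ?fmorph_eq0 // gt_eqF.
have -> : sgz (iota C) = sgz (iota C * T p1.2).
  by rewrite sgzM (gtr0_sgz T1) mulr1.
move: (iota C * T p1.2) B_small => x; move: B => y.
have [x0|x0|//] := ltgtP x 0.
  rewrite (ltr0_norm x0) ltr_norml => /andP[_ yx] _.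
  by rewrite !ltr0_sgz //; lra.
rewrite (gtr0_norm x0) ltr_norml => /andP[yx _] _.
by rewrite !gtr0_sgz //; lra.
Qed.

(** * The formula expressing that a point is near the set *)

Section FormulaBlocks.
Variable K : Type.

Definition exists_block (k n : nat) (f : ord.formula K) : ord.formula K :=
  foldr (fun i => ord.Exists i) f (seq.iota k n).

(** Binding the variables [k, ..., k + n - 1] and equating them to 0: a way to read
free variables of [f] as 0 in a longer environment without substituting. *)
Definition zero_block (k n : nat) (f : ord.formula K) : ord.formula K :=
  foldr (fun i g => ord.Exists i
    (ord.And (ord.Equal (GRing.Var K i) (GRing.NatConst K 0)) g)) f (seq.iota k n).

Definition conj_block (n : nat) (F : nat -> ord.formula K) : ord.formula K :=
  foldr (fun i g => ord.And (F i) g) (ord.Bool true) (seq.iota 0 n).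

End FormulaBlocks.

Section MapBlocks.
Variables (K L : Type) (iota : K -> L).

Lemma map_formula_and f g : map_formula iota (ord.And f g) =
  ord.And (map_formula iota f) (map_formula iota g).
Proof. by []. Qed.

Lemma map_exists_block k n f :
  map_formula iota (exists_block k n f) = exists_block k n (map_formula iota f).
Proof. by rewrite /exists_block; elim: (seq.iota k n) => //= i s ->. Qed.

Lemma map_zero_block k n f :
  map_formula iota (zero_block k n f) = zero_block k n (map_formula iota f).
Proof. by rewrite /zero_block; elim: (seq.iota k n) => //= i s ->. Qed.

Lemma map_conj_block n F :
  map_formula iota (conj_block n F) = conj_block n (map_formula iota \o F).
Proof. by rewrite /conj_block; elim: (seq.iota 0 n) => //= i s ->. Qed.

End MapBlocks.

Section HoldsBlocks.
Variable L : realFieldType.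

Lemma rformula_exists_block k n (f : ord.formula L) :
  ord.rformula (exists_block k n f) = ord.rformula f.
Proof. by rewrite /exists_block; elim: (seq.iota k n). Qed.

Lemma rformula_zero_block k n (f : ord.formula L) :
  ord.rformula (zero_block k n f) = ord.rformula f.
Proof. by rewrite /zero_block; elim: (seq.iota k n). Qed.

Lemma rformula_conj_block n (F : nat -> ord.formula L) :
  ord.rformula (conj_block n F) = all (fun i => ord.rformula (F i)) (seq.iota 0 n).
Proof. by rewrite /conj_block; elim: (seq.iota 0 n) => //= i s ->. Qed.

Lemma rformula_and (f g : ord.formula L) :
  ord.rformula (ord.And f g) = ord.rformula f && ord.rformula g.
Proof. by []. Qed.

Lemma set_nth_cat_size (pre : seq L) (y x : L) s :
  set_nth 0 (pre ++ y :: s) (size pre) x = rcons pre x ++ s.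
Proof. by elim: pre => //= a pre ->. Qed.

Lemma holds_exists_block pre mid rest (f : ord.formula L) :
  ord.holds (pre ++ mid ++ rest) (exists_block (size pre) (size mid) f) <->
  exists2 xs, size xs = size mid & ord.holds (pre ++ xs ++ rest) f.
Proof.
elim: mid pre => [|y mid IH] pre.
  by split=> [h|[xs /size0nil -> h]]; [exists [::] | exact: h].
rewrite /exists_block /=; split=> [[x]|[[|x xs] //= [sz_xs] h]].
  rewrite set_nth_cat_size -(size_rcons pre x) => /IH[xs sz_xs].
  by rewrite cat_rcons => h; exists (x :: xs); rewrite /= ?sz_xs.
exists x; rewrite set_nth_cat_size -(size_rcons pre x); apply/IH.
by exists xs; rewrite // cat_rcons.
Qed.

Lemma holds_zero_block pre mid (f : ord.formula L) :
  ord.holds (pre ++ mid) (zero_block (size pre) (size mid) f) <-> ord.holds pre f.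
Proof.
elim: mid pre => [|y mid IH] pre; first by rewrite cats0.
rewrite /zero_block /=.
have -> : ord.holds pre f <-> ord.holds (rcons pre 0) f.
  have E : GRing.same_env pre (rcons pre 0).
    move=> i; rewrite nth_rcons; case: ltngtP => // [lt_i|->].
      by rewrite nth_default // ltnW.
    by rewrite nth_default.
  split; first exact: ord.eq_holds.
  by apply: ord.eq_holds => i; rewrite E.
rewrite -IH size_rcons; split=> [[x]|h].
  rewrite set_nth_cat_size cat_rcons nth_cat ltnn subnn /= => -[-> h].
  by rewrite cat_rcons; exact: h.
exists 0; rewrite set_nth_cat_size; split; last exact: h.
by rewrite /= cat_rcons nth_cat ltnn subnn.
Qed.

Lemma holds_conj_block n (F : nat -> ord.formula L) e :
  ord.holds e (conj_block n F) <-> forall i, (i < n)%N -> ord.holds e (F i).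
Proof.
rewrite /conj_block.
have -> : (forall i, (i < n)%N -> ord.holds e (F i)) <->
    (forall i, (i \in seq.iota 0 n) -> ord.holds e (F i)).
  by split=> h i; have := h i; rewrite mem_iota.
elim: (seq.iota 0 n) => [|i s IH] /=; first by split.
rewrite IH; split=> [[h1 h2] j|h].
  by rewrite inE => /orP[/eqP ->//|/h2].
by split=> [|j js]; apply: h; rewrite inE ?eqxx // js orbT.
Qed.

Lemma holds_and (f g : ord.formula L) e :
  ord.holds e (ord.And f g) <-> ord.holds e f /\ ord.holds e g.
Proof. by []. Qed.

Lemma row_of_seq (n : nat) (xs : seq L) : size xs = n ->
  exists x : 'rV[L]_n, xs = [seq x ord0 i | i : 'I_n].
Proof.
move=> <-; exists (\row_i xs`_i); apply: (@eq_from_nth _ 0).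
  by rewrite size_map size_enum_ord.
move=> i lt_i; pose j := Ordinal lt_i.
by rewrite (nth_codom_ord (fun k => _) j) mxE.
Qed.

End HoldsBlocks.

(** The bound variables [x] have the indices [0, ..., n - 1]; the parameters [z]
come next, and the last variable, of index [n + n], is the factor [d].  The
variables of [f] beyond [x] must be read as 0, although their indices are those
of the parameters: hence the [zero_block]. *)
Definition near_formula (K : Type) (n : nat) (f : ord.formula K) : ord.formula K :=
  let d := GRing.Var K (n + n) in
  exists_block 0 n (ord.And (zero_block n n.+1 f)
    (conj_block n (fun i =>
       ord.And (ord.Le (GRing.Var K (n + i)) (GRing.Mul d (GRing.Var K i)))
               (ord.Le (GRing.Var K i) (GRing.Mul d (GRing.Var K (n + i))))))).

Definition near_point (L : realFieldType) (n : nat) (f : ord.formula L)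
    (z : 'I_n -> L) (d : L) : Prop :=
  exists2 x : 'rV[L]_n, ord.holds [seq x ord0 i | i : 'I_n] f &
    forall i, z i <= d * x ord0 i /\ x ord0 i <= d * z i.

Definition extend (L : Type) (n : nat) (z : 'I_n -> L) (d : L) : 'I_n.+1 -> L :=
  fun i => if unlift ord_max i is Some j then z j else d.

Lemma extend_max (L : Type) n (z : 'I_n -> L) d : extend z d ord_max = d.
Proof. by rewrite /extend unlift_none. Qed.

Lemma extend_lift (L : Type) n (z : 'I_n -> L) d i :
  extend z d (widen_ord (leqnSn n) i) = z i.
Proof.
rewrite /extend; have -> : widen_ord (leqnSn n) i = lift ord_max i.
  by apply: val_inj; rewrite /= /bump leqNgt ltn_ord.
by rewrite liftK.
Qed.

Lemma holds_near_formula (L : realFieldType) n (f : ord.formula L)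
    (z : 'I_n -> L) d :
  ord.holds (zeros_then n (extend z d)) (near_formula n f) <-> near_point f z d.
Proof.
rewrite /near_formula /zeros_then.
set rest := [seq _ | _ : _].
have sz_rest : size rest = n.+1 by rewrite size_map size_enum_ord.
have restz (i : 'I_n) : rest`_i = z i.
  by rewrite (nth_codom_ord _ (widen_ord (leqnSn n) i)) extend_lift.
have restd : rest`_n = d by rewrite (nth_codom_ord _ ord_max) extend_max.
set F := ord.And _ _.
have := holds_exists_block [::] (nseq n 0) rest F; rewrite cat0s size_nseq => ->.
rewrite {}/F.
split=> [[xs /row_of_seq[x ->] /holds_and[]]|[x fx xz]].
  set xs' := [seq _ | _ : _].
  have szx : size xs' = n by rewrite size_map size_enum_ord.
  have := holds_zero_block xs' rest f; rewrite szx sz_rest cat0s => -> fx /holds_conj_block xz.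
  exists x => // i; have /= := xz i (ltn_ord i).
  rewrite !nth_cat szx ltn_ord !ltnNge !leq_addr /= !addKn restz restd.
  by rewrite nth_codom_ord.
exists [seq x ord0 i | i : 'I_n]; first by rewrite size_map size_enum_ord.
set xs' := [seq _ | _ : _].
have szx : size xs' = n by rewrite size_map size_enum_ord.
rewrite cat0s; apply/holds_and; split.
  by have := holds_zero_block xs' rest f; rewrite szx sz_rest => ->.
apply/holds_conj_block => i lt_i; have /= := xz (Ordinal lt_i).
rewrite !nth_cat szx lt_i !ltnNge !leq_addr /= !addKn restd.
by rewrite (restz (Ordinal lt_i)) (nth_codom_ord _ (Ordinal lt_i)).
Qed.

Lemma near_formula_rformula (L : realFieldType) n (f : ord.formula L) :
  ord.rformula f -> ord.rformula (near_formula n f).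
Proof.
move=> rf; rewrite rformula_exists_block /= rformula_zero_block rf.
by rewrite rformula_conj_block; apply/allP.
Qed.

Lemma map_near_formula (K L : Type) (iota : K -> L) n f :
  map_formula iota (near_formula n f) = near_formula n (map_formula iota f).
Proof. by rewrite map_exists_block /= map_zero_block map_conj_block. Qed.

(** * From subpolynomial to bounded distance *)

(** The monomials [E], evaluated at [z], are ordered by the weight [w] up to the
factor [delta]: a larger weight means a smaller value, as for powers of an
infinitesimal. *)
Definition follows (R L : realFieldType) (iota : R -> L) (m : nat)
    (E : seq {ffun 'I_m -> nat}) (w : {ffun 'I_m -> nat} -> R) (delta : R)
    (z : 'I_m -> L) : Prop :=
  [/\ forall i, 0 < z i,
      {in E &, forall a b, w a = w b -> monomial z a = monomial z b} &
      {in E &, forall a b, w a < w b -> monomial z b <= iota delta * monomial z a}].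

Lemma follows_same_sign (R : rcfType) (m : nat)
    (ls : seq (seq (R * {ffun 'I_m -> nat}))) (w : {ffun 'I_m -> nat} -> R) :
  exists2 delta : R, 0 < delta &
    forall (L1 L2 : realFieldType) (iota1 : {rmorphism R -> L1})
      (iota2 : {rmorphism R -> L2}) z1 z2,
      follows iota1 (flatten (map (map snd) ls)) w delta z1 ->
      follows iota2 (flatten (map (map snd) ls)) w delta z2 ->
      {in ls, forall l, sgz (poly_value iota1 z1 l) = sgz (poly_value iota2 z2 l)}.
Proof.
elim: ls => [|l ls [d d0 IH]]; first by exists 1.
have [d' d'0 [s sP]] := dominant_sign l w.
exists (Num.min d d'); first by rewrite lt_min d0.
have shrink (L : realFieldType) (iota : {rmorphism R -> L}) z (d1 : R) E :
    Num.min d d' <= d1 ->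
    {subset E <= flatten (map (map snd) (l :: ls))} ->
    follows iota (flatten (map (map snd) (l :: ls))) w (Num.min d d') z ->
    follows iota E w d1 z.
  move=> le_d sub [z0 zeq zlt]; split=> // [a b /sub aE /sub bE|a b /sub aE /sub bE].
    exact: zeq.
  move=> /(zlt _ _ aE bE)/le_trans; apply.
  by rewrite ler_wpM2r ?(ltW (monomial_gt0 _ _)) // rcf_morph_mono.
have subl : {subset map snd l <= flatten (map (map snd) (l :: ls))}.
  by move=> a al; rewrite mem_cat al.
have sub2 : {subset flatten (map (map snd) ls) <= flatten (map (map snd) (l :: ls))}.
  by move=> a al; rewrite mem_cat al orbT.
move=> L1 L2 i1 i2 z1 z2 f1 f2 l'; rewrite inE => /orP[/eqP ->|l's]; last first.
  apply: IH => //; [apply: (shrink _ i1)|apply: (shrink _ i2)] => //;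
    by rewrite ge_min lexx.
have le_d' : Num.min d d' <= d' by rewrite ge_min lexx orbT.
have [z10 z1eq z1lt] := shrink _ _ _ _ _ le_d' subl f1.
have [z20 z2eq z2lt] := shrink _ _ _ _ _ le_d' subl f2.
rewrite /poly_value (sP _ i1) ?(sP _ i2) // => a _; exact: monomial_gt0.
Qed.

Lemma near_lower_bound (R : realFieldType) (s : seq R) :
  exists2 eps : R, 0 < eps & {in s, forall x, 0 < x -> eps < x}.
Proof.
elim: s => [|x s [e e0 eP]]; first by exists 1.
have [x0|x0] := ltP 0 x; last first.
  exists e => // y; rewrite inE => /orP[/eqP ->|/eP//].
  by rewrite ltNge x0.
exists (Num.min e (x / 2)); first by rewrite lt_min e0 divr_gt0.
move=> y; rewrite inE => /orP[/eqP -> _|/eP h /h lt_ey].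
  by rewrite gt_min orbC ltr_pdivrMr //; apply/orP; left; lra.
by rewrite gt_min lt_ey.
Qed.

Definition init_exp (n : nat) (a : {ffun 'I_n.+1 -> nat}) : {ffun 'I_n -> nat} :=
  [ffun i => a (widen_ord (leqnSn n) i)].

Lemma monomial_extend (L : realFieldType) n (z : 'I_n -> L) d a :
  monomial (extend z d) a = monomial z (init_exp a) * d ^+ a ord_max.
Proof.
rewrite /monomial big_ord_recr /= extend_max; congr (_ * _).
by apply: eq_bigr => i _; rewrite extend_lift ffunE.
Qed.

Lemma extend_gt0 (L : realFieldType) n (z : 'I_n -> L) d :
  (forall i, 0 < z i) -> 0 < d -> forall i, 0 < extend z d i.
Proof. by move=> z0 d0 i; rewrite /extend; case: unlift. Qed.

(** The weight of [d] is [- eps], negative and very small, in the hypothesis on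
[(z, d)]; in the conclusion [d] is replaced by a real constant [D >= 1/delta].
In both cases monomials with different weights in [z] are ordered by these,
and monomials with the same weight in [z] are ordered by their degree in [d].
So [follows] holds in both cases with the same weight function, and the
polynomials in the formula for nearness have the same signs. *)
Lemma near_point_two_scales (R : rcfType) (n : nat) (f : ord.formula R)
    (u : {ffun 'I_n -> nat} -> R) : ord.rformula f ->
  exists (E : seq {ffun 'I_n.+1 -> nat}) (eps delta : R),
    [/\ 0 < eps, 0 < delta &
    forall (z : 'I_n -> R) d,
      follows idfun E (fun a => u (init_exp a) - eps * (a ord_max)%:R) delta
        (extend z d) ->
      near_point f z d ->
    exists (S : seq {ffun 'I_n -> nat}) (eta D : R), [/\ 0 < eta, 1 <= D &
    forall (L : rcfType) (iota : {rmorphism R -> L}) (z' : 'I_n -> L),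
      follows iota S u eta z' -> near_point (map_formula iota f) z' (iota D)]].
Proof.
move=> /(near_formula_rformula n)/uniform_qe[g [qg rg gP]].
have [ls lsP] := qf_sign_polys n n.+1 qg rg.
pose E := flatten (map (map snd) ls).
pose top (a : {ffun 'I_n.+1 -> nat}) := a ord_max.
(* eps is below all the nonzero gaps, so that the contribution of d to the weight
   never reverses the order given by z. *)
pose gap a b : R := `|u (init_exp a) - u (init_exp b)| / (top a + top b).+1%:R.
have [eps eps0 epsP] := near_lower_bound [seq gap a b | a <- E, b <- E].
pose w a : R := u (init_exp a) - eps * (top a)%:R.
have gapP : {in E &, forall a b, u (init_exp a) != u (init_exp b) ->
    eps * (top a)%:R + eps * (top b)%:R < `|u (init_exp a) - u (init_exp b)|}.
  move=> a b aE bE ab.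
  have : eps < gap a b.
    apply: epsP; first exact: allpairs_f.
    by rewrite divr_gt0 ?ltr0Sn // normr_gt0 subr_eq0.
  rewrite /gap ltr_pdivlMr ?ltr0Sn //; apply: le_lt_trans.
  by rewrite -mulrDr -natrD ler_pM2l // ler_nat.
have top0 a : 0 <= eps * (top a)%:R by rewrite mulr_ge0 ?ler0n ?ltW.
have w_eq : {in E &, forall a b, w a = w b ->
    u (init_exp a) = u (init_exp b) /\ top a = top b}.
  move=> a b aE bE wab.
  have [ab|/(gapP _ _ aE bE) H] := eqVneq (u (init_exp a)) (u (init_exp b)).
    split=> //; move: wab; rewrite /w ab => /addrI/oppr_inj/mulfI.
    by move=> /(_ (lt0r_neq0 eps0))/eqP; rewrite eqr_nat => /eqP.
  move: H; rewrite ltNge.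
  have -> : u (init_exp a) - u (init_exp b) = eps * (top a)%:R - eps * (top b)%:R.
    by move: wab; rewrite /w => wab; lra.
  by case/negP; rewrite ler_norml; have a0 := top0 a; have b0 := top0 b;
    apply/andP; split; lra.
have w_lt : {in E &, forall a b, w a < w b ->
    u (init_exp a) < u (init_exp b) \/
    u (init_exp a) = u (init_exp b) /\ (top b < top a)%N}.
  move=> a b aE bE wab.
  have [ab|ab|ab] := ltgtP (u (init_exp a)) (u (init_exp b)).
  - by left.
  - have := gapP _ _ aE bE; rewrite gt_eqF // => /(_ isT).
    rewrite gtr0_norm ?subr_gt0 //; move: wab; rewrite /w.
    by have := top0 a; have := top0 b; lra.
  - right; split=> //; move: wab; rewrite /w ab ltrD2l ltrN2 ltr_pM2l //.
    by rewrite ltr_nat.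
have [delta delta0 sign] := follows_same_sign ls w.
exists E, eps, delta; split=> // z d fz near_z.
pose D : R := Num.max 1 delta^-1; pose K := \max_(a <- E) top a.
have D1 : 1 <= D by rewrite le_max lexx.
have D0 : 0 < D by apply: lt_le_trans D1.
have dD : 1 <= delta * D.
  by rewrite mulrC -ler_pdivrMr // mul1r le_max lexx orbT.
have topK a : a \in E -> (top a <= K)%N by move=> aE; apply: leq_bigmax_seq.
(* The factor D ^+ K absorbs the powers of D occurring in the monomials. *)
exists (map (@init_exp n) E), (delta / D ^+ K), D; split=> //.
  by rewrite divr_gt0 ?exprn_gt0.
move=> L iota z' [z'0 z'eq z'lt].
have mono := rcf_morph_mono iota.
have fz' : follows iota E w delta (extend z' (iota D)).
  split.
  - by apply: extend_gt0 => //; rewrite -(rmorph0 iota) (leW_mono mono).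
  - move=> a b aE bE /(w_eq _ _ aE bE)[uab tab].
    rewrite !monomial_extend -/(top a) -/(top b) tab.
    by rewrite (z'eq (init_exp a) (init_exp b)) ?map_f.
  - have scale M c1 k1 c2 k2 : 0 < M -> c1 * D ^+ k1 <= c2 * D ^+ k2 ->
        iota c1 * M * iota D ^+ k1 <= iota c2 * (M * iota D ^+ k2).
      move=> M0 le12; rewrite -!rmorphXn mulrA [iota c1 * M]mulrC.
      rewrite [iota c2 * M]mulrC -!mulrA -!rmorphM.
      by rewrite ler_pM2l // mono.
    have Mgt0 a := monomial_gt0 (init_exp a) z'0.
    move=> a b aE bE /(w_lt _ _ aE bE)[uab|[uab tab]];
      rewrite !monomial_extend -/(top a) -/(top b).
      apply: le_trans (_ : iota (delta / D ^+ K) * monomial z' (init_exp a) *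
        iota D ^+ top b <= _).
        rewrite ler_wpM2r ?z'lt ?map_f //.
        by rewrite exprn_ge0 // -(rmorph0 iota) mono ltW.
      apply: scale => //.
      rewrite -mulrA ler_pM2l // ler_pdivrMl ?exprn_gt0 //.
      by rewrite -exprD ler_weXn2l // (leq_trans (topK b bE)) ?leq_addr.
    rewrite (z'eq (init_exp b) (init_exp a)) ?map_f //.
    rewrite -[X in X * _ <= _]mul1r -(rmorph1 iota); apply: scale => //.
    rewrite mul1r -(subnKC tab) addSn -addnS exprD mulrCA.
    rewrite -[leLHS]mulr1 ler_pM2l ?exprn_gt0 // (le_trans dD) //.
    by rewrite ler_pM2l // ler_eXnr.
have := lsP _ _ _ _ _ _ (sign _ _ idfun iota _ _ fz fz').
rewrite -(gP R idfun) -(gP L iota) !map_near_formula map_formula_id.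
by rewrite !holds_near_formula => <-.
Qed.

(** * Rational vectors with the same relations *)

Definition dot (R : realFieldType) (n : nat) (lam : 'I_n -> R)
    (a : {ffun 'I_n -> nat}) : R := \sum_i (a i)%:R * lam i.

(** The equalities [dot lam a = dot lam b] put [lam] in the kernel of a rational
matrix [M].  This kernel is spanned by rational vectors, so approximating the
coordinates of [lam] on them gives rational vectors of the kernel near [lam].
The strict inequalities persist for vectors close enough. *)
Lemma rational_same_relations (R : realType) (n : nat) (lam : 'I_n -> R)
    (S : seq {ffun 'I_n -> nat}) (eps : R) : 0 < eps ->
  exists q : 'I_n -> rat,
    [/\ forall i, `|ratr (q i) - lam i| < eps,
        {in S &, forall a b, dot lam a = dot lam b ->
          dot (ratr \o q : 'I_n -> R) a = dot (ratr \o q) b} &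
        {in S &, forall a b, dot lam a < dot lam b ->
          dot (ratr \o q : 'I_n -> R) a < dot (ratr \o q) b}].
Proof.
move=> eps0.
pose P := [seq p <- [seq (a, b) | a <- S, b <- S] | dot lam p.1 == dot lam p.2].
pose M : 'M[rat]_(n, size P) := \matrix_(i, j)
  (((tnth (in_tuple P) j).1 i)%:R - ((tnth (in_tuple P) j).2 i)%:R).
pose K := kermx M.
have : (\row_i lam i <= map_mx (ratr : rat -> R) K)%MS.
  rewrite map_kermx; apply/sub_kermxP/matrixP => i j; rewrite !mxE.
  set p := tnth (in_tuple P) j.
  have : p \in P by apply: mem_tnth.
  rewrite mem_filter => /andP[/eqP p12 _].
  rewrite -[RHS](subrr (dot lam p.2)) -{1}p12 /dot -sumrB.
  apply: eq_bigr => k _.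
  by rewrite !mxE rmorphB !rmorph_nat mulrBr ![lam k * _]mulrC.
move=> /submxP[u uE].
pose B : R := 1 + \sum_k \sum_i `|ratr (K k i)|.
pose A : R := 1 + \sum_(a <- S) \sum_i (a i)%:R.
have [g g0 gP] := near_lower_bound [seq dot lam b - dot lam a | a <- S, b <- S].
have B0 : 0 < B by rewrite ltr_wpDr // sumr_ge0 // => k _; rewrite sumr_ge0.
have A0 : 0 < A by rewrite ltr_wpDr // sumr_ge0 // => k _; rewrite sumr_ge0.
pose eta := Num.min eps (g / (2 * A)).
have eta0 : 0 < eta by rewrite lt_min eps0 divr_gt0 // mulr_gt0.
have near_u k : exists r : rat, `|ratr r - u ord0 k| < eta / B.
  have eB : 0 < eta / B by rewrite divr_gt0.
  have [|r] := @rat_in_itvoo R (u ord0 k - eta / B) (u ord0 k + eta / B).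
    by lra.
  by rewrite in_itv /= => /andP[r1 r2]; exists r; rewrite ltr_norml; lra.
pose u' : 'rV[rat]_n := \row_k xchoose (near_u k).
have u'P k : `|ratr (u' ord0 k) - u ord0 k| < eta / B.
  by rewrite mxE; exact: (xchooseP (near_u k)).
pose q i := (u' *m K) ord0 i.
have q_near i : `|ratr (q i) - lam i| < eta.
  have -> : lam i = (u *m map_mx ratr K) ord0 i by rewrite -uE mxE.
  rewrite /q !mxE rmorph_sum -sumrB.
  apply: le_lt_trans (ler_norm_sum _ _ _) _.
  apply: (@le_lt_trans _ _ (eta / B * \sum_k `|ratr (K k i)|)).
    rewrite mulr_sumr; apply: ler_sum => k _.
    by rewrite [map_mx _ _ _ _]mxE rmorphM -mulrBl normrM ler_wpM2r // ltW // u'P.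
  rewrite mulrAC ltr_pdivrMr // ltr_pM2l //.
  rewrite /B; apply: (@le_lt_trans _ _ (\sum_k \sum_j `|ratr (K k j)|)); last by lra.
  by apply: ler_sum => k _; rewrite (bigD1 i) //= lerDl sumr_ge0.
exists q; split.
- by move=> i; apply: lt_le_trans (q_near i) _; rewrite ge_min lexx.
- move=> a b aS bS ab.
  have pP : (a, b) \in P by rewrite mem_filter ab eqxx /= allpairs_f.
  have [j jE] := tnthP (in_tuple P) _ pP.
  apply/eqP; rewrite -subr_eq0 /dot -sumrB; apply/eqP.
  have : (u' *m K *m M) ord0 j = 0 by rewrite -mulmxA mulmx_ker mulmx0 mxE.
  rewrite mxE => E0; rewrite -[RHS](rmorph0 (@ratr R)) -E0.
  rewrite rmorph_sum; apply: eq_bigr => i _; rewrite /= [M i j]mxE -jE /=.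
  by rewrite rmorphM rmorphB !rmorph_nat /q; ring.
- move=> a b aS bS ab.
  have dot_near c : c \in S -> `|dot (ratr \o q) c - dot lam c| <= eta * (A - 1).
    move=> cS; rewrite /dot -sumrB; apply: le_trans (ler_norm_sum _ _ _) _.
    apply: (@le_trans _ _ (eta * \sum_i (c i)%:R)).
      rewrite mulr_sumr; apply: ler_sum => i _; rewrite /= -mulrBr normrM normr_nat.
      by rewrite mulrC ler_wpM2r // ltW // q_near.
    rewrite ler_pM2l // /A addrC addKr (big_rem c) //= lerDl sumr_ge0 // => d _.
    by rewrite sumr_ge0.
  have : g < dot lam b - dot lam a.
    by apply: gP; [exact: allpairs_f | rewrite subr_gt0].
  have := dot_near a aS; have := dot_near b bS; rewrite !ler_norml.
  have : eta * A <= g / 2.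
    rewrite -ler_pdivlMr // -mulrA -invfM.
    by rewrite ge_min lexx orbT.
  by move=> h1 /andP[h2 h3] /andP[h4 h5] h6; lra.
Qed.

(** * Logarithmic limit sets and real powers *)

Lemma log_limit_setP (R : realType) (n : nat) (V : set 'rV[R]_n) y :
  log_limit_set V y <-> forall eps : R, 0 < eps ->
    exists s : R, [/\ 0 < s < 1, s < eps &
      exists2 x : 'rV[R]_n, V x &
        forall i, `|logb s^-1 (x ord0 i) - y ord0 i| < eps].
Proof.
rewrite /log_limit_set /lim_family /=; split=> [yV eps eps0|h].
  have [|[x s] [/=]] := yV (ball (y, 0) eps); first exact: nbhsx_ballx.
  move=> [s01 [x' x'V <-]] [/= xy se]; exists s; split=> //.
    have /andP[s0 _] := s01.
    by move: se; rewrite /ball /= sub0r normrN gtr0_norm.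
  exists x' => // i; have := xy.2 ord0 i.
  by rewrite /ball /= mxE distrC.
move=> U /nbhs_ballP[eps /= eps0 epsU].
have [s [s01 se [x Vx xy]]] := h _ eps0.
exists (map_mx (logb s^-1) x, s); split; first by split=> //; exists x.
apply: epsU; split=> /=.
  by split=> // i j; rewrite /ball /= mxE (ord1 i) distrC.
by rewrite /ball /= sub0r normrN gtr0_norm //; case/andP: s01.
Qed.

Lemma closure_rowP (R : realType) (n : nat) (A : set 'rV[R]_n) y :
  closure A y <-> forall eps : R, 0 < eps ->
    exists2 x : 'rV[R]_n, A x & forall i, `|x ord0 i - y ord0 i| < eps.
Proof.
split=> [yA eps eps0|h U /nbhs_ballP[eps /= eps0 epsU]].
  have [|x [Ax xy]] := yA (ball y eps); first exact: nbhsx_ballx.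
  by exists x => // i; have := xy.2 ord0 i; rewrite /ball /= distrC.
have [x Ax xy] := h _ eps0; exists x; split => //; apply: epsU.
by split=> // i j; rewrite /ball /= (ord1 i) distrC.
Qed.
Section RealPowers.
Variable R : realType.

Lemma powR_gt1_anti (s x y : R) : 0 < s < 1 -> x <= y -> s `^ y <= s `^ x.
Proof.
move=> /andP[s0 s1] xy; rewrite /powR gt_eqF // ler_expR ler_wnM2r //.
by rewrite -ln1 ler_ln ?posrE // ltW.
Qed.

Lemma powRD_pos (s x y : R) : 0 < s -> s `^ (x + y) = s `^ x * s `^ y.
Proof. by move=> s0; rewrite powRD //; apply/implyP => _; rewrite gt_eqF. Qed.

Lemma monomial_powR (m : nat) (s : R) (lam : 'I_m -> R) a : 0 < s ->
  monomial (fun i => s `^ lam i) a = s `^ dot lam a.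
Proof.
move=> s0; rewrite /dot (big_morph _ (fun x y => powRD_pos x y s0) (powRr0 s)).
by apply: eq_bigr => i _; rewrite mulrC powRrM powR_mulrn // powR_ge0.
Qed.

Lemma powR_small (P : seq R) (delta : R) : 0 < delta ->
  exists2 s0 : R, 0 < s0 &
    forall s, 0 < s < s0 -> {in P, forall x, 0 < x -> s `^ x <= delta}.
Proof.
move=> d0; elim: P => [|x P [s1 s10 IH]]; first by exists 1.
exists (Num.min s1 (delta `^ x^-1)); first by rewrite lt_min s10 powR_gt0.
move=> s /andP[s0]; rewrite lt_min => /andP[ss1 sd] y.
rewrite inE => /orP[/eqP -> x0|yP]; last by apply: IH; rewrite ?s0.
rewrite -[leRHS](powRr1 (ltW d0)) -(mulVf (lt0r_neq0 x0)) powRrM.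
by apply: ge0_ler_powR; rewrite ?nnegrE ?powR_ge0 //; apply: ltW.
Qed.

(** At [z = s ^ lam] the monomial [a] has the value [s ^ (dot lam a)], so it is
enough that [w] and [dot lam] order the monomials of [E] in the same way. *)
Lemma follows_powR (m : nat) (E : seq {ffun 'I_m -> nat})
    (w : {ffun 'I_m -> nat} -> R) (lam : 'I_m -> R) (delta : R) :
  0 < delta ->
  {in E &, forall a b, w a = w b -> dot lam a = dot lam b} ->
  {in E &, forall a b, w a < w b -> dot lam a < dot lam b} ->
  exists2 s0 : R, 0 < s0 &
    forall s, 0 < s < s0 -> follows idfun E w delta (fun i => s `^ lam i).
Proof.
move=> d0 weq wlt.
have [s0 s00 sP] := powR_small [seq dot lam b - dot lam a | a <- E, b <- E] d0.
exists s0 => // s ss0; have /andP[s_gt0 _] := ss0; split.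
- by move=> i; exact: powR_gt0.
- by move=> a b aE bE wab; rewrite !monomial_powR // (weq a b).
- move=> a b aE bE wab; rewrite !monomial_powR //=.
  rewrite -[dot lam b](subrK (dot lam a)) powRD_pos // ler_pM2r ?powR_gt0 //.
  by apply: sP => //; [exact: allpairs_f | rewrite subr_gt0 wlt].
Qed.

Lemma powR_logb (s x : R) : 0 < s < 1 -> 0 < x -> x = s `^ (- logb s^-1 x).
Proof.
move=> /andP[s0 s1] x0; rewrite /powR gt_eqF // /logb lnV ?posrE //.
have ln_s : ln s != 0.
  by rewrite lt_eqF // -ln1 ltr_ln ?posrE.
by rewrite invrN mulrN opprK mulfVK // lnK.
Qed.

Lemma dot_extend (n : nat) (lam : 'I_n -> R) c a :
  dot (extend lam c) a = dot lam (init_exp a) + (a ord_max)%:R * c.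
Proof.
rewrite /dot big_ord_recr /= extend_max; congr (_ + _).
by apply: eq_bigr => i _; rewrite extend_lift ffunE.
Qed.

(** At [z = s ^ (- y)] and [d = s ^ (- eps)] the hypotheses of
[near_point_two_scales] are those of membership in the limit set. *)
Lemma log_limit_near_point (n : nat) (phi : ord.formula R) (y : 'rV[R]_n) :
  ord.rformula phi -> defset phi `<=` @pos_orthant R n ->
  log_limit_set (defset phi) y ->
  exists (S : seq {ffun 'I_n -> nat}) (eta D : R), [/\ 0 < eta, 1 <= D &
    forall (L : rcfType) (iota : {rmorphism R -> L}) (z : 'I_n -> L),
      follows iota S (dot (fun i => - y ord0 i)) eta z ->
      near_point (map_formula iota phi) z (iota D)].
Proof.
move=> rphi phi_pos /log_limit_setP yV.
pose lam i := - y ord0 i.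
have [E [eps [delta [eps0 delta0 key]]]] := near_point_two_scales (dot lam) rphi.
have wE a : dot (extend lam (- eps)) a =
    dot lam (init_exp a) - eps * (a ord_max)%:R.
  by rewrite dot_extend mulrN mulrC.
have [||s0 s00 sP] := @follows_powR _ E
  (fun a => dot lam (init_exp a) - eps * (a ord_max)%:R)
  (extend lam (- eps)) _ delta0.
- by move=> a b _ _; rewrite !wE.
- by move=> a b _ _; rewrite !wE.
have [|s [s01 s_lt [x Vx xy]]] := yV (Num.min eps s0).
  by rewrite lt_min eps0.
apply: (key (fun i => s `^ lam i) (s `^ (- eps))).
  have := sP s; rewrite (andP s01).1 (lt_le_trans s_lt) ?ge_min ?lexx ?orbT //.
  have -> : (fun i => s `^ extend lam (- eps) i) =
      extend (fun i => s `^ lam i) (s `^ (- eps)).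
    by apply/funext => i; rewrite /extend; case: unlift.
  exact.
exists x => // i; have := xy i; rewrite lt_min => /andP[].
rewrite ltr_norml => /andP[y1 y2] _.
have s_gt0 := (andP s01).1.
rewrite [x ord0 i](powR_logb s01); last exact: phi_pos.
by rewrite -!powRD_pos // !powR_gt1_anti // /lam; lra.
Qed.

(** A bounded factor [D] changes logarithms in base [1/s] by at most
[ln D / - ln s], which tends to 0 with [s]. *)
Lemma near_powers_log_limit (n : nat) (phi : ord.formula R) (lam : 'I_n -> R)
    (D s0 : R) : 1 <= D -> 0 < s0 -> defset phi `<=` @pos_orthant R n ->
  (forall s, 0 < s < s0 -> near_point phi (fun i => s `^ lam i) D) ->
  log_limit_set (defset phi) (\row_i - lam i).
Proof.
move=> D1 s00 phi_pos nearP; apply/log_limit_setP => eps eps0.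
pose s1 := Num.min (Num.min s0 eps) (expR (- (ln D / eps + 1))).
have s10 : 0 < s1 by rewrite !lt_min s00 eps0 expR_gt0.
have lnD : 0 <= ln D by rewrite -ln1 ler_ln ?posrE // (lt_le_trans ltr01).
pose s := s1 / 2.
have s_gt0 : 0 < s by rewrite divr_gt0.
have : s < s1 by rewrite ltr_pdivrMr // ltr_pMr // ltr1n.
rewrite !lt_min -andbA => /and3P[ss0 seps sD].
have ln_s : ln D / eps + 1 < - ln s.
  by rewrite ltrNr -ltr_expR lnK.
have s_lt1 : s < 1.
  apply: lt_le_trans sD _; rewrite -[leRHS]expR0 ler_expR oppr_le0.
  by rewrite addr_ge0 // divr_ge0 // ltW.
exists s; split=> //; first by rewrite s_gt0.
have [|x Vx xz] := nearP s; first by rewrite s_gt0.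
exists x => // i; have [zx xz'] := xz i.
have x0 : 0 < x ord0 i by apply: phi_pos.
have D0 : 0 < D by apply: lt_le_trans D1.
have z0 : 0 < s `^ lam i by exact: powR_gt0.
have h1 : lam i * ln s <= ln D + ln (x ord0 i).
  by rewrite -ln_powR -lnM ?posrE // ler_ln ?posrE // mulr_gt0.
have h2 : ln (x ord0 i) <= ln D + lam i * ln s.
  by rewrite -ln_powR -lnM ?posrE // ler_ln ?posrE // mulr_gt0.
have ls0 : 0 < - ln s by apply: le_lt_trans ln_s; rewrite addr_ge0 // divr_ge0 // ltW.
rewrite mxE /logb lnV ?posrE // opprK.
have -> : ln (x ord0 i) / - ln s + lam i = (ln (x ord0 i) - lam i * ln s) / - ln s.
  by field; rewrite lt_eqF // -oppr_gt0.
rewrite normrM normfV (gtr0_norm ls0) ltr_pdivrMr //.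
apply: (@le_lt_trans _ _ (ln D)); first by rewrite ler_norml; apply/andP; split; lra.
rewrite mulrC -ltr_pdivrMr //; lra.
Qed.

(** The criterion of [log_limit_near_point] for [lam = - y] only involves the order
of the weights of the monomials in [S], which a rational vector near [y]
reproduces. *)
Lemma log_limit_rational_dense (n : nat) (phi : ord.formula R) :
  ord.rformula phi -> defset phi `<=` @pos_orthant R n ->
  forall y eps, log_limit_set (defset phi) y -> 0 < eps ->
  exists2 q : 'I_n -> rat, forall i, `|ratr (q i) - y ord0 i| < eps &
    exists (S : seq {ffun 'I_n -> nat}) (eta D : R), [/\ 0 < eta, 1 <= D &
      forall (L : rcfType) (iota : {rmorphism R -> L}) (z : 'I_n -> L),
      follows iota S (dot (fun i => - ratr (q i))) eta z ->
      near_point (map_formula iota phi) z (iota D)].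
Proof.
move=> rphi phi_pos y eps yV eps0.
have [S [eta [D [eta0 D1 key]]]] := log_limit_near_point rphi phi_pos yV.
have [q [q_near qeq qlt]] := rational_same_relations (fun i => - y ord0 i) S eps0.
have qN : (fun i => - ratr (- q i) : R) = ratr \o q.
  by apply/funext => i /=; rewrite rmorphN opprK.
exists (fun i => - q i).
  by move=> i; have := q_near i; rewrite opprK rmorphN -opprD normrN.
exists S, eta, D; split=> // L iota z; rewrite qN => -[z0 zeq zlt].
apply: key; split=> // a b aS bS.
  by move=> /(qeq _ _ aS bS); apply: zeq.
by move=> /(qlt _ _ aS bS); apply: zlt.
Qed.

End RealPowers.
(** * Valuations of rank one *)

Section RankOne.
Variables (R : realType) (F : rcfType) (iota : {rmorphism R -> F}).
Variables (v : F -> R) (t : F).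
Hypothesis vP : rank_one_valuation iota v t.

Let iota_mono : {mono iota : x y / x <= y} := rcf_morph_mono iota.

Let iota_gt0 c : (0 < iota c) = (0 < c).
Proof. by rewrite -(rmorph0 iota) (leW_mono iota_mono). Qed.

Lemma valM x y : x != 0 -> y != 0 -> v (x * y) = v x + v y.
Proof. by have [[vM _] _ _ _] := vP; apply: vM. Qed.

Lemma val1 : v 1 = 0.
Proof.
by have := @valM 1 1; rewrite mulr1 oner_eq0 => /(_ isT isT) h; lra.
Qed.

Lemma valV x : x != 0 -> v x^-1 = - v x.
Proof.
move=> x0; have := @valM x x^-1 x0; rewrite invr_eq0 x0 mulfV // val1.
by move=> /(_ isT) h; lra.
Qed.

Lemma valX x n : x != 0 -> v (x ^+ n) = n%:R * v x.
Proof.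
move=> x0; elim: n => [|n IH]; first by rewrite expr0 mul0r val1.
by rewrite exprS valM ?expf_neq0 // IH -natr1 mulrDl mul1r addrC.
Qed.

Lemma valXz x (m : int) : x != 0 -> v (x ^ m) = m%:~R * v x.
Proof.
move=> x0; case: m => m; first by rewrite -exprnP valX.
by rewrite NegzE -exprnN valV ?expf_neq0 // valX // rmorphN mulNr.
Qed.

Lemma val_ge0 x : x != 0 -> 0 <= v x <-> exists a b, iota a <= x <= iota b.
Proof.
move=> x0; have [_ vE _ _] := vP.
have : valuation_ring v x = convex_hull_of iota x by rewrite vE.
rewrite /valuation_ring /convex_hull_of /= => <-.
by split=> [|[/eqP|//]]; [right | rewrite (negbTE x0)].
Qed.

(** The valuation ring is convex and contains 1, hence contains [x / y]. *)
Lemma val_anti x y : 0 < x -> x <= y -> v y <= v x.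
Proof.
move=> x0 xy; have y0 : 0 < y by apply: lt_le_trans xy.
have yn0 := lt0r_neq0 y0; have xn0 := lt0r_neq0 x0.
have : 0 <= v (x / y).
  apply/val_ge0; first by rewrite mulf_neq0 ?invr_eq0.
  exists 0, 1; rewrite rmorph0 rmorph1 ler_pdivrMr // mul1r xy andbT.
  by rewrite divr_ge0 // ltW.
by rewrite valM ?invr_eq0 // valV // subr_ge0.
Qed.

Lemma val_lt x y : 0 < x -> 0 < y -> v x < v y -> y < x.
Proof. by move=> x0 y0; apply: contraTT; rewrite -!leNgt; apply: val_anti. Qed.

Lemma val_iota c : 0 < c -> v (iota c) = 0.
Proof.
move=> c0; have ge0 d : 0 < d -> 0 <= v (iota d).
  move=> d0; apply/val_ge0; first by rewrite fmorph_eq0 lt0r_neq0.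
  by exists d, d; rewrite lexx.
have := ge0 c^-1; rewrite invr_gt0 fmorphV valV ?fmorph_eq0 ?lt0r_neq0 //.
by move=> /(_ c0); have := ge0 c c0; lra.
Qed.

Lemma val_monomial n (z : 'I_n -> F) a : (forall i, 0 < z i) ->
  v (monomial z a) = dot (v \o z) a.
Proof.
move=> z0; rewrite /monomial /dot.
have : \prod_i z i ^+ a i != 0 /\
    v (\prod_i z i ^+ a i) = \sum_i (a i)%:R * (v \o z) i.
  elim/big_rec2: _ => [|i x y _ [y0 IH]]; first by rewrite oner_eq0 val1.
  have z1 : z i ^+ a i != 0 by rewrite expf_neq0 // lt0r_neq0.
  by rewrite mulf_neq0 // valM // IH valX // lt0r_neq0.
by case.
Qed.

(** Elements with different valuations differ by more than any real factor, so only
the equalities between monomials have to be assumed. *)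
Lemma follows_val n (S : seq {ffun 'I_n -> nat}) (z : 'I_n -> F) eta :
  0 < eta -> (forall i, 0 < z i) ->
  {in S &, forall a b, dot (v \o z) a = dot (v \o z) b ->
    monomial z a = monomial z b} ->
  follows iota S (dot (v \o z)) eta z.
Proof.
move=> eta0 z0 zeq; split=> // a b _ _; rewrite -!val_monomial // => lt_v.
have m0 c := monomial_gt0 c z0.
apply/ltW/val_lt; rewrite ?mulr_gt0 ?iota_gt0 //.
by rewrite valM ?val_iota ?add0r // lt0r_neq0 ?iota_gt0.
Qed.

(** A real factor does not change valuations. *)
Lemma near_point_Log n (phi : ord.formula R) (z : 'I_n -> F) D :
  1 <= D -> (forall i, 0 < z i) -> near_point (map_formula iota phi) z (iota D) ->
  Log v (extension iota phi) (\row_i - v (z i)).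
Proof.
move=> D1 z0 [x Vx xz]; exists x => //; apply/rowP => i; rewrite !mxE.
have [zx xz'] := xz i.
have D0 : 0 < D by apply: lt_le_trans D1.
have iD0 : 0 < iota D by rewrite iota_gt0.
have x0 : 0 < x ord0 i by rewrite -(pmulr_rgt0 _ iD0); apply: lt_le_trans zx.
have := val_anti (z0 i) zx; have := val_anti x0 xz'.
rewrite !valM ?lt0r_neq0 // val_iota // !add0r => h1 h2.
by congr (- _); apply/eqP; rewrite eq_le h1 h2.
Qed.

Lemma exists_transfer (f : ord.formula R) (h : seq F) : ord.rformula f ->
  ord.holds h (map_formula iota f) ->
  exists2 x : seq R, size x = size h & ord.holds x f.
Proof.
move=> rf hf.
have := @rcf_elementary _ _ iota (exists_block 0 (size h) f) (nseq (size h) 0).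
rewrite rformula_exists_block map_exists_block => /(_ rf).
have := holds_exists_block [::] (nseq (size h) 0) [::] f.
have := holds_exists_block [::] (nseq (size h) 0) [::] (map_formula iota f).
rewrite !size_nseq !cats0 !cat0s map_nseq rmorph0 => -> -> [_].
case; first by exists h; rewrite // cat0s cats0.
by move=> x sz_x; rewrite cat0s cats0; exists x.
Qed.

Lemma extension_pos n (phi : ord.formula R) : ord.rformula phi ->
  defset phi `<=` @pos_orthant R n -> extension iota phi `<=` @pos_orthant F n.
Proof.
move=> rphi phi_pos h Vh i; rewrite ltNge; apply/negP => hi.
pose f := ord.And phi (ord.Le (GRing.Var R i) (GRing.NatConst R 0)).
have [||x sz_x] := @exists_transfer f [seq h ord0 j | j : 'I_n].
- by rewrite /= rphi.
- by split=> //=; rewrite nth_codom_ord.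
rewrite size_map size_enum_ord in sz_x.
have [x' ->] := row_of_seq sz_x; rewrite /f /= nth_codom_ord => -[Vx].
by rewrite leNgt (phi_pos _ Vx i).
Qed.

Lemma t_gt0 : 0 < t. Proof. by case: vP. Qed.

Lemma t_infinitesimal c : 0 < c -> t < iota c.
Proof.
move=> c0; apply: val_lt; rewrite ?iota_gt0 ?t_gt0 // val_iota //.
by case: vP => _ _ _ ->.
Qed.

(** Let [y = - v h].  With [N * y_i + M] strictly between the natural numbers [P_i]
and [P_i + 2], the valuations give [t ^ M < h_i ^ N * t ^ P_i] and
[h_i ^ N * t ^ (P_i + 2) < t ^ M]; the shift by [M] only serves to keep the
exponents natural.  By transfer these inequalities have a real solution
[(x, s)] with [s] small, and they put the logarithm of [x_i] in base [1/s]
within [2 / N] of [y_i]. *)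
Lemma Log_sub_log_limit n (phi : ord.formula R) : ord.rformula phi ->
  defset phi `<=` @pos_orthant R n ->
  Log v (extension iota phi) `<=` log_limit_set (defset phi : set 'rV[R]_n).
Proof.
move=> rphi phi_pos _ [h Vh <-]; apply/log_limit_setP => eps eps0.
have h0 := extension_pos rphi phi_pos Vh.
pose y i : R := (map_mx (fun x => - v x) h) ord0 i.
have yE i : y i = - v (h ord0 i) by rewrite /y mxE.
pose N := (Num.truncn (2 / eps)).+1.
pose M := \max_i (Num.truncn (N%:R * `|y i|)).+2.
have N_eps : 2 < N%:R * eps by rewrite -ltr_pdivrMr // truncnS_gt.
have M_y i : 1 <= N%:R * y i + M%:R.
  have : (Num.truncn (N%:R * `|y i|)).+2%:R <= M%:R :> R.
    by rewrite ler_nat; exact: leq_bigmax.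
  have := truncnS_gt (N%:R * `|y i|); rewrite -[_.+2%:R]natr1.
  have : - (N%:R * y i) <= N%:R * `|y i|.
    by rewrite -mulrN ler_wpM2l // -normrN ler_norm.
  by lra.
pose T (i : nat) := Num.truncn (N%:R * [seq y j | j : 'I_n]`_i + M%:R).
have TP (i : 'I_n) : (T i)%:R <= N%:R * y i + M%:R < (T i).+1%:R /\ (0 < T i)%N.
  rewrite /T nth_codom_ord; set r := _ + _.
  have r1 : 1 <= r by exact: M_y.
  by rewrite truncn_itv ?(le_trans _ r1) // truncn_gt0.
pose xN i := GRing.Exp (GRing.Var R i) N.
pose tX k := GRing.Exp (GRing.Var R n) k.
pose c := Num.min 1 eps.
have c0 : 0 < c by rewrite lt_min ltr01.
pose f := ord.And (zero_block n 1 phi) (ord.And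
  (ord.And (ord.Lt (GRing.NatConst R 0) (GRing.Var R n))
           (ord.Lt (GRing.Var R n) (GRing.Const c)))
  (conj_block n (fun i => ord.And
    (ord.Lt (tX M) (GRing.Mul (xN i) (tX (T i).-1)))
    (ord.Lt (GRing.Mul (xN i) (tX (T i).+1)) (tX M))))).
pose hs := [seq h ord0 j | j : 'I_n].
have sz_hs : size hs = n by rewrite size_map size_enum_ord.
have vt : v t = 1 by case: vP.
have [||xs sz_xs] := @exists_transfer f (hs ++ [:: t]).
- rewrite /f !rformula_and rformula_zero_block rphi rformula_conj_block /=.
  by apply/allP.
- rewrite /f !map_formula_and map_zero_block map_conj_block.
  apply/holds_and; split.
    have := holds_zero_block hs [:: t] (map_formula iota phi).
    by rewrite sz_hs => ->.
  have hst : (hs ++ [:: t])`_n = t by rewrite nth_cat sz_hs ltnn subnn.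
  apply/holds_and; split; first by rewrite /= hst t_gt0 t_infinitesimal.
  apply/holds_conj_block => i lt_i /=; rewrite hst nth_cat sz_hs lt_i.
  rewrite (nth_codom_ord (fun j => h ord0 j) (Ordinal lt_i)).
  set hi := h _ _; have hi0 : 0 < hi by exact: h0.
  have [/andP[T1 T2] T3] := TP (Ordinal lt_i).
  have hn0 := lt0r_neq0 hi0; have tn0 := lt0r_neq0 t_gt0.
  have yi : y (Ordinal lt_i) = - v hi by rewrite yE.
  split; apply: val_lt; rewrite ?mulr_gt0 ?exprn_gt0 ?t_gt0 //.
    rewrite valM ?expf_neq0 // !valX // vt !mulr1; move: T1.
    by rewrite /= yi -(prednK T3) -natr1; lra.
  rewrite valM ?expf_neq0 // !valX // vt !mulr1; move: T2.
  by rewrite /= yi; lra.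
rewrite size_cat /= addn1 sz_hs in sz_xs.
have [x [s xsE]] : exists x : 'rV[R]_n, exists s : R,
    xs = [seq x ord0 j | j : 'I_n] ++ [:: s].
  case: (lastP xs) sz_xs => // xs' s; rewrite size_rcons => -[/row_of_seq[x ->]].
  by exists x, s; rewrite cats1.
set xs' := [seq _ | _ : _] in xsE.
have sz_x : size xs' = n by rewrite size_map size_enum_ord.
have xst : xs`_n = s by rewrite xsE nth_cat sz_x ltnn subnn.
rewrite /f => /holds_and[Vx [[s0 sc] /holds_conj_block box]].
rewrite /= xst in s0; rewrite /= xst lt_min in sc; have /andP[s1 s_eps] := sc.
have {}Vx : defset phi x.
  by move: Vx; rewrite xsE; have := holds_zero_block xs' [:: s] phi; rewrite sz_x => ->.
exists s; rewrite s0; split=> //; exists x => // i.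
have := box i (ltn_ord i); rewrite /= xst xsE nth_cat sz_x ltn_ord nth_codom_ord.
have x0 : 0 < x ord0 i by exact: phi_pos.
have s01 : 0 < s < 1 by rewrite s0.
set r := logb s^-1 (x ord0 i).
have -> : x ord0 i = s `^ (- r) by exact: powR_logb.
have powE k : s ^+ k = s `^ k%:R by rewrite powR_mulrn // ltW.
have powE' k : (s `^ (- r)) ^+ k = s `^ (- r * k%:R).
  by rewrite powRrM powR_mulrn // powR_ge0.
have anti a b : s `^ a < s `^ b -> b < a.
  by apply: contraTT; rewrite -!leNgt; apply: powR_gt1_anti.
rewrite powE' !powE -!powRD_pos // => -[/anti r1 /anti r2].
have N0 : 0 < N%:R :> R by rewrite ltr0Sn.
rewrite -/(y i) -(ltr_pM2l N0) -[X in X * `|_|](gtr0_norm N0) -normrM ltr_norml.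
have [] := TP i; case: (T i) r1 r2 => // k /= r1 r2 /andP[T1 T2] _.
have k1 : k.+1%:R = k%:R + 1 :> R by rewrite natr1.
have k2 : k.+2%:R = k%:R + 2 :> R by rewrite -addn2 natrD.
by rewrite k1 in T1; rewrite k2 in r2 T2; apply/andP; split; lra.
Qed.

End RankOne.
(** * Points with prescribed rational valuations *)

Lemma rcf_root (F : rcfType) (x : F) (N : nat) : 0 < x -> (0 < N)%N ->
  exists2 r : F, 0 < r & r ^+ N = x.
Proof.
move=> x0 N0; pose p := 'X^N - x%:P.
have [||r /andP[r0 _]] := @poly_ivt F p 0 (1 + x).
- by rewrite addr_ge0 // ltW.
- rewrite !hornerE expr0n gtn_eqF //= sub0r oppr_le0 (ltW x0) /= subr_ge0.
  rewrite -(prednK N0) exprS; apply: le_trans (_ : (1 + x) * 1 <= _).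
    by rewrite mulr1 lerDr.
  by rewrite ler_pM2l ?ltr_wpDl // exprn_ege1 // lerDl ltW.
rewrite /root !hornerE subr_eq0 => /eqP rN; exists r => //.
rewrite lt_def r0 andbT; apply: contraTneq x0 => r00.
by rewrite -rN r00 expr0n gtn_eqF // ltxx.
Qed.

Lemma common_denominator (n : nat) (q : 'I_n -> rat) :
  exists2 N : nat, (0 < N)%N &
    exists m : 'I_n -> int, forall i, q i * N%:R = (m i)%:~R.
Proof.
exists (\prod_i `|denq (q i)|)%N.
  by apply: prodn_gt0 => i; rewrite absz_gt0 denq_neq0.
exists (fun i => numq (q i) * (\prod_(j | j != i) `|denq (q j)|)%N%:R) => i.
rewrite (bigD1 i) //= natrM mulrA rmorphM /= rmorph_nat; congr (_ * _).
rewrite -{1}[q i]divq_num_den -[(`|_|%N)%:R]/((`|denq (q i)|%N%:Z)%:~R) absz_denq.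
by rewrite divfK // intr_eq0 denq_neq0.
Qed.

(** For every [n], both [n * f x] and [n * (f 1 * x)] lie between [f 1 * k] and
[f 1 * (k + 1)], where [k] is the integral part of [n * x]. *)
Lemma additive_monotone_linear (R : realType) (f : R -> R) :
  (forall x y, f (x + y) = f x + f y) -> (forall x y, x <= y -> f x <= f y) ->
  forall x, f x = f 1 * x.
Proof.
move=> fD fmono x.
have f0 : f 0 = 0 by have := fD 0 0; rewrite addr0; lra.
have fN y : f (- y) = - f y by have := fD y (- y); rewrite subrr f0; lra.
have fM y (n : nat) : f (n%:R * y) = n%:R * f y.
  elim: n => [|n IH]; first by rewrite !mul0r.
  by rewrite -natr1 !mulrDl !mul1r fD IH.
have fZ (m : int) : f m%:~R = f 1 * m%:~R.
  have fn k : f k%:R = f 1 * k%:R by rewrite -[k%:R in LHS]mulr1 fM mulrC.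
  by case: m => m; rewrite ?NegzE ?rmorphN /= ?fN ?mulrN -pmulrn fn.
have f1 : 0 <= f 1 by rewrite -f0 fmono.
have close (n : nat) : `|f x - f 1 * x| * n%:R <= f 1.
  rewrite -[X in _ * X]normr_nat -normrM mulrBl mulrC -fM.
  set y := n%:R * x; rewrite -mulrA [x * _]mulrC -/y.
  have /andP[y1 y2] := Num.Theory.floor_itv y.
  have := fmono _ _ y1; have := fmono _ _ (ltW y2); rewrite !fZ rmorphD /=.
  have := ler_wpM2l f1 y1; have := ler_wpM2l f1 (ltW y2); rewrite rmorphD /=.
  rewrite ler_norml => *; apply/andP; split; lra.
apply/eqP; rewrite -subr_eq0 -normr_eq0 eq_le normr_ge0 andbT leNgt.
apply/negP => d0; have := close (Num.truncn (f 1 / `|f x - f 1 * x|)).+1.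
by rewrite leNgt mulrC -ltr_pdivrMr // truncnS_gt.
Qed.

Section RationalPoints.
Variables (R : realType) (F : rcfType) (iota : {rmorphism R -> F}).
Variables (v : F -> R) (t : F).
Hypothesis vP : rank_one_valuation iota v t.

(** All the [z i] are integral powers of a single [N]-th root of [t], so a monomial
is determined by its valuation. *)
Lemma rational_powers (n : nat) (q : 'I_n -> rat) :
  exists2 z : 'I_n -> F, (forall i, 0 < z i) /\ (forall i, v (z i) = - ratr (q i)) &
    forall a b, dot (v \o z) a = dot (v \o z) b -> monomial z a = monomial z b.
Proof.
have [N N0 [m mE]] := common_denominator q.
have [r r0 rN] := rcf_root (t_gt0 vP) N0.
have rn0 := lt0r_neq0 r0.
have N0' : N%:R != 0 :> R by rewrite pnatr_eq0 -lt0n.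
have vr : N%:R * v r = 1.
  by rewrite -(valX vP) // rN; case: vP.
have vz i : v (r ^ (- m i)) = - ratr (q i).
  rewrite (valXz vP) // mulrNz mulNr; congr (- _).
  have : (ratr (q i) : R) * N%:R = (m i)%:~R.
    by have := congr1 (@ratr R) (mE i); rewrite rmorphM /= rmorph_nat ratr_int.
  by move=> <-; rewrite -mulrA vr mulr1.
exists (fun i => r ^ (- m i)); first by split=> // i; rewrite exprz_gt0.
have mon a : monomial (fun i => r ^ (- m i)) a = r ^ (\sum_i - m i * (a i)%:Z).
  rewrite /monomial (big_morph (exprz r) (fun x y => expfzDr x y rn0) (expr0z r)).
  by apply: eq_bigr => i _; rewrite exprnP exprz_exp.
move=> a b; rewrite -!(val_monomial vP) => [|i|i]; rewrite ?exprz_gt0 // !mon.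
have vr0 : v r != 0.
  by apply/eqP => vr0; move/eqP: vr; rewrite vr0 mulr0 eq_sym oner_eq0.
by rewrite !(valXz vP) // => /(mulIf vr0)/intr_inj ->.
Qed.

Lemma log_limit_sub_closure (n : nat) (phi : ord.formula R) :
  ord.rformula phi -> defset phi `<=` @pos_orthant R n ->
  log_limit_set (defset phi : set 'rV[R]_n) `<=` closure (Log v (extension iota phi)).
Proof.
move=> rphi phi_pos y yV; apply/closure_rowP => eps eps0.
have [q q_near [S [eta [D [eta0 D1 key]]]]] :=
  log_limit_rational_dense rphi phi_pos yV eps0.
have [z [z0 vz] zeq] := rational_powers q.
exists (\row_i - v (z i)).
  apply: (near_point_Log vP D1 z0); apply: key.
  have -> : (fun i => - ratr (q i)) = v \o z by apply/funext => i /=; rewrite vz.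
  by apply: (follows_val vP) => // a b _ _; apply: zeq.
by move=> i; rewrite mxE vz opprK.
Qed.

End RationalPoints.

(** * Points with prescribed real valuations over the Hardy field *)

Section HardyPoints.
Variables (R : realType) (F : rcfType) (iota : {rmorphism R -> F}).
Variables (v : F -> R) (t : F).
Hypothesis vP : rank_one_valuation iota v t.
Variable j : {rmorphism hardy R -> F}.
Hypothesis j_le : forall a b, germ_le a b <-> j a <= j b.
Hypothesis j_cst : forall c : R, j (germ (cst_dfun c)) = iota c.

Lemma pow_definable_power (mu : R) : pow_definable (power mu).
Proof.
exists (PAnd (PNot (PLe (PVar R 0) (PConst 0))) (PEq (PVar R 1) (PPow mu (PVar R 0)))).
move=> x y /=; split=> -[h1 h2]; split => //.
  by rewrite ltNge; apply/negP.
by apply/negP; rewrite -ltNge.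
Qed.

Definition power_dfun (mu : R) : definable_fun R :=
  DefinableFun (introT (asboolP _) (pow_definable_power mu)).

Definition hardy_power (mu : R) : F := j (germ (power_dfun mu)).

Lemma hardy_powerD mu nu : hardy_power (mu + nu) = hardy_power mu * hardy_power nu.
Proof.
rewrite /hardy_power -rmorphM /= -[_ * _ in RHS]/(germ _ * germ _).
have -> : germ (power_dfun mu) * germ (power_dfun nu) =
    germ (power_dfun mu * power_dfun nu) by rewrite /germ rmorphM.
congr (j _); apply/germ_eqP; near=> x.
have x0 : 0 < x by near: x; exact: nbhs_right_gt.
by rewrite dfunM /= /power !x0 powRD_pos.
Unshelve. all: by end_near.
Qed.

Lemma hardy_power0 : hardy_power 0 = 1.
Proof.
rewrite /hardy_power -(rmorph1 j); have -> : 1 = germ (1 : definable_fun R).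
  by rewrite /germ rmorph1.
congr (j _); apply/germ_eqP; near=> x.
have x0 : 0 < x by near: x; exact: nbhs_right_gt.
by rewrite dfun1 /= /power x0 powRr0.
Unshelve. all: by end_near.
Qed.

Lemma hardy_power_gt0 mu : 0 < hardy_power mu.
Proof.
rewrite lt_def; apply/andP; split.
  apply: contraTneq (oner_neq0 F) => mu0.
  by rewrite -hardy_power0 -(subrr mu) hardy_powerD mu0 mul0r eqxx.
rewrite -(rmorph0 j); apply/j_le.
exists 0, (power_dfun mu); split=> //; first by rewrite /germ rmorph0.
near=> x; have x0 : 0 < x by near: x; exact: nbhs_right_gt.
by rewrite dfun0 /= /power x0 powR_ge0.
Unshelve. all: by end_near.
Qed.

Lemma hardy_power_small mu nu delta : mu < nu -> 0 < delta ->
  hardy_power nu <= iota delta * hardy_power mu.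
Proof.
move=> lt_mn d0; rewrite -j_cst -rmorphM; apply/j_le.
exists (power_dfun nu), (cst_dfun delta * power_dfun mu); split=> //.
  by rewrite /germ rmorphM.
have [s0 s00 sP] := powR_small [:: nu - mu] d0.
near=> x; have x0 : 0 < x by near: x; exact: nbhs_right_gt.
rewrite dfunM /= /power x0 -[nu](subrK mu) powRD_pos // ler_pM2r ?powR_gt0 //.
by apply: sP; rewrite ?mem_head ?subr_gt0 // x0; near: x; exact: nbhs_right_lt.
Unshelve. all: by end_near.
Qed.

Lemma val_hardy_power mu : v (hardy_power mu) = v (hardy_power 1) * mu.
Proof.
apply: (additive_monotone_linear (f := v \o hardy_power)) => /= [x y|x y].
  by rewrite hardy_powerD (valM vP) // lt0r_neq0 ?hardy_power_gt0.
rewrite le_eqVlt => /orP[/eqP -> //|/hardy_power_small/(_ ltr01)].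
by rewrite rmorph1 mul1r; apply: (val_anti vP); exact: hardy_power_gt0.
Qed.

(** The germ of the identity is smaller than every positive real, so its inverse is
not in the convex hull of the reals. *)
Lemma val_hardy_power1_gt0 : 0 < v (hardy_power 1).
Proof.
have h0 := hardy_power_gt0 1; have hn0 := lt0r_neq0 h0.
rewrite ltNge; apply/negP => v0.
have hi0 : (hardy_power 1)^-1 != 0 by rewrite invr_eq0.
have /(val_ge0 vP hi0)[a [b /andP[_ hb]]] : 0 <= v (hardy_power 1)^-1.
  by rewrite (valV vP) // oppr_ge0.
have mono := rcf_morph_mono iota.
pose c : R := Num.max b 1.
have c0 : 0 < c by rewrite lt_max ltr01 orbT.
have hc : (hardy_power 1)^-1 <= iota c.
  by apply: le_trans hb _; rewrite mono le_max lexx.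
have := @hardy_power_small 0 1 (2 * c)^-1 ltr01; rewrite invr_gt0 mulr_gt0 //.
move=> /(_ isT); rewrite hardy_power0 mulr1 fmorphV => h2.
have ic0 : 0 < iota c by rewrite -(rmorph0 iota) (leW_mono mono).
have : 1 <= iota c * hardy_power 1 by rewrite -ler_pdivrMr // div1r.
apply/negP; rewrite -ltNge -ltr_pdivlMl // mulr1.
apply: le_lt_trans h2 _; rewrite ltf_pV2 ?posrE ?rmorphM ?rmorph_nat ?mulr_gt0 //.
by rewrite ltr_pMl // ltr1n.
Qed.

Lemma log_limit_sub_Log (n : nat) (phi : ord.formula R) :
  ord.rformula phi -> defset phi `<=` @pos_orthant R n ->
  log_limit_set (defset phi : set 'rV[R]_n) `<=` Log v (extension iota phi).
Proof.
move=> rphi phi_pos y yV.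
have [S [eta [D [eta0 D1 key]]]] := log_limit_near_point rphi phi_pos yV.
have k0 := val_hardy_power1_gt0; have kn0 := lt0r_neq0 k0.
pose k := v (hardy_power 1).
pose z i := hardy_power (- y ord0 i / k).
have z0 i : 0 < z i by exact: hardy_power_gt0.
have vz i : v (z i) = - y ord0 i by rewrite val_hardy_power mulrC divfK.
have -> : y = \row_i - v (z i).
  by apply/rowP => i; rewrite mxE vz opprK.
apply: (near_point_Log vP D1 z0); apply: key.
have -> : (fun i => - y ord0 i) = v \o z by apply/funext => i /=; rewrite vz.
have mon a : monomial z a = hardy_power (dot (v \o z) a / k).
  rewrite /monomial /dot mulr_suml (big_morph _ hardy_powerD hardy_power0).
  apply: eq_bigr => i _ /=; rewrite vz -mulrA -/(z i).
  elim: (a i) => [|m IH]; first by rewrite mul0r hardy_power0.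
  by rewrite -natr1 mulrDl mul1r hardy_powerD exprSr IH.
by apply: (follows_val vP) => // a b _ _ E; rewrite !mon E.
Qed.

End HardyPoints.

(** * Density, comparison and closedness *)

Theorem corollary4p6 (R : realType) (n : nat) (V : set 'rV[R]_n)
    (Vpos : V `<=` @pos_orthant R n) (Vsa : semialgebraic V) :
  log_limit_set V `<=` closure (log_limit_set V `&` @rational_points R n) /\
  forall (F : rcfType) (iota : {rmorphism R -> F}) (v : F -> R) (t : F),
    rank_one_valuation iota v t ->
    forall phi : ord.formula R, ord.rformula phi -> V = defset phi ->
    let Vbar : set 'rV[F]_n := extension iota phi in
    log_limit_set V = closure (Log v Vbar) /\
    (extends_hardy iota -> closure (Log v Vbar) = Log v Vbar).
Proof.
split.
  have [phi [_ rphi VE]] := Vsa; rewrite VE in Vpos *.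
  move=> y yV; apply/closure_rowP => eps eps0.
  have [q q_near [S [eta [D [eta0 D1 key]]]]] :=
    log_limit_rational_dense rphi Vpos yV eps0.
  exists (\row_i ratr (q i)); last by move=> i; rewrite mxE.
  split; last by exists (\row_i q i); apply/rowP => i; rewrite !mxE.
  have [||s0 s00 sP] := @follows_powR _ _ S (dot (fun i => - ratr (q i)))
    (fun i => - ratr (q i)) eta eta0; [by [] | by [] |].
  have -> : \row_i ratr (q i) = \row_i - - ratr (q i) :> 'rV[R]_n.
    by apply/rowP => i; rewrite !mxE opprK.
  apply: (near_powers_log_limit D1 s00 Vpos) => s s0s.
  by have := key R idfun _ (sP s s0s); rewrite map_formula_id.
move=> F iota v t vP phi rphi VE Vbar; rewrite VE in Vpos *.
have lim_sub := log_limit_sub_closure vP rphi Vpos.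
have Log_sub := Log_sub_log_limit vP rphi Vpos.
have closedL : closure (Log v Vbar) `<=` log_limit_set (defset phi : set 'rV[R]_n).
  move=> y /closure_rowP yL; apply/log_limit_setP => eps eps0.
  have e2 : 0 < eps / 2 by rewrite divr_gt0.
  have [x /Log_sub/log_limit_setP xV xy] := yL _ e2.
  have [s [s01 s_eps [h Vh hx]]] := xV _ e2.
  exists s; split=> //; first by apply: lt_trans s_eps _; lra.
  exists h => // i; have := ltrD (hx i) (xy i); rewrite -splitr.
  apply: le_lt_trans.
  have := ler_normD (logb s^-1 (h ord0 i) - x ord0 i) (x ord0 i - y ord0 i).
  by rewrite addrA subrK.
split; first by apply/seteqP; split.
move=> [j [j_le j_cst]]; apply/seteqP; split; last exact: subset_closure.
by move=> y /closedL; apply: (log_limit_sub_Log vP j_le j_cst).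
Qed.
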